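(* Let $\mathcal F$ be a countable class of measurable functions on $S$, uniformly bounded (in absolute value) by $1/2$. Then, for every $t>0$, $$\Pr\Bigl\{\Bigl\|\sum_{i=1}^n\bigl(f(X_i)-Ef(X)\bigr)\Bigr\|_{\mathcal F}\ge2\Bigl\|\sum_{i=1}^n\varepsilon_if(X_i)\Bigr\|_{\mathcal F}+3t\Bigr\}\le2\exp\Bigl(-\frac{t^2}{2V'+2t}\Bigr),$$ as well as $$\Pr\Bigl\{\Bigl\|\sum_{i=1}^n\bigl(f(X_i)-Ef(X)\bigr)\Bigr\|_{\mathcal F}\ge2E^\varepsilon\Bigl\|\sum_{i=1}^n\varepsilon_if(X_i)\Bigr\|_{\mathcal F}+3t\Bigr\}\le2\exp\Bigl(-\frac{t^2}{2V'+2t}\Bigr),$$ where $V'=n\sigma^2+4E\bigl\|\sum_{i=1}^n\varepsilon_if(X_i)\bigr\|_{\mathcal F}$.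
   Context: $(S,\mathcal S)$ is a measurable space, $P$ a probability measure on it, and $X,X_1,X_2,\ldots$ are i.i.d. with law $P$ (the $X_i$ being coordinates of a product probability space). $\varepsilon_1,\varepsilon_2,\ldots$ are i.i.d. Rademacher random variables (values $\pm1$ with probability $1/2$), independent of the $X_i$, all defined as coordinates on a large product probability space. $E^\varepsilon$ denotes expectation with respect to the Rademacher variables only. For a map $H$ on $\mathcal F$, $\|H(f)\|_{\mathcal F}=\sup_{f\in\mathcal F}|H(f)|$. $\sigma$ is any number with $\sigma\le1/2$ and $\sigma^2\ge\sup_{f\in\mathcal F}Pf^2$, where $Pf=\int f\,dP$. *)

(* Defs.v *)
From HB Require Import structures.
From mathcomp Require Import all_boot all_order all_algebra.
From mathcomp Require Import all_classical all_reals all_analysis.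

Set Implicit Arguments.
Unset Strict Implicit.
Unset Printing Implicit Defensive.

Import Order.TTheory GRing.Theory Num.Theory.
Import numFieldNormedType.Exports.

Local Open Scope classical_set_scope.
Local Open Scope ring_scope.

(* [sup] is the real supremum: this is the usual sup-norm when [H] is bounded on
   [F], and [0] when [F] is empty. *)
Definition supnorm (R : realType) (T : Type) (F : set T) (H : T -> R) : R :=
  sup [set `|H f| | f in F].

Definition mutually_independent (d d' : measure_display)
    (T : measurableType d) (T' : measurableType d') (R : realType)
    (P : probability T R) (X : nat -> {RV P >-> T'}) : Prop :=
  forall (J : seq nat) (A : nat -> set T'), uniq J ->
    (forall i, measurable (A i)) ->
    P (\bigcap_(i in [set` J]) X i @^-1` A i)
    = (\prod_(i <- J) P (X i @^-1` A i))%E.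

(* Stated on measurable sets only: a measure is an arbitrary set function
   elsewhere. *)
Definition has_law (d d' : measure_display)
    (T : measurableType d) (T' : measurableType d') (R : realType)
    (P : probability T R) (X : {RV P >-> T'}) (Q : probability T' R) : Prop :=
  forall A, measurable A -> distribution P X A = Q A.

Definition rademacher (d : measure_display) (T : measurableType d)
    (R : realType) (P : probability T R) (e : {RV P >-> R}) : Prop :=
  P (e @^-1` [set 1]) = (2^-1)%:E /\ P (e @^-1` [set -1]) = (2^-1)%:E.

(* The ambient space is [OX * Oe] with the product probability [PX \x Pe]; the
   [X i] depend on the first coordinate only and the signs on the second only,
   so the two sequences are independent of each other. *)
Section processes.
Context (dX de dS : measure_display) (OX : measurableType dX)
  (Oe : measurableType de) (S : measurableType dS) (R : realType).

Definition empirical_norm (PX : probability OX R) (X : {RV PX >-> S})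
    (Xs : nat -> {RV PX >-> S}) (F : set (S -> R)) (n : nat)
    (w : OX * Oe) : R :=
  supnorm F (fun f => \sum_(i < n) (f (Xs i w.1) - fine 'E_PX[f \o X])).

Definition rademacher_norm (PX : probability OX R) (Pe : probability Oe R)
    (Xs : nat -> {RV PX >-> S}) (eps : nat -> {RV Pe >-> R})
    (F : set (S -> R)) (n : nat) (w : OX * Oe) : R :=
  supnorm F (fun f => \sum_(i < n) eps i w.2 * f (Xs i w.1)).

(* Expectation with respect to the second coordinate, the first one fixed. *)
Definition Eeps (Pe : probability Oe R) (Z : OX * Oe -> R) (w : OX * Oe) : R :=
  fine 'E_Pe[fun w2 => Z (w.1, w2)].

End processes.

(* Main.v *)
Require Import Defs.
From HB Require Import structures.
From mathcomp Require Import all_boot all_order all_algebra.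
From mathcomp Require Import all_classical all_reals all_analysis.
From mathcomp Require Import measurable_realfun ring lra.

(** Write [Z] for the supremum over [F] of the centred sums, [Y] for the
    supremum of the sums weighted by the signs, and [T] for either [Y] or its
    expectation over the signs.  If [2 T + 3 t <= Z], then [2 E Y + t <= Z] or
    [T < E Y - t], so a tail bound of the right size for each of these two
    events proves the theorem.  The split works because centring is
    dominated by symmetrization, [E Z <= 2 E Y] ([symmetrization]): the bound
    [2 E Y + t] is then a deviation of [Z] above its mean by at least [t].

    Both tails come from the entropy method.  Let [M] be the maximum over a
    finite class of the sums of a function over [n] independent letters, all
    functions being centred with second moment at most [s2].  Entropy is
    subadditive over the letters ([entropy_tensorization]), and each
    letter contributes an explicit function of the increment of [M]
    when this letter is added.  The increment lies above the value, at the new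
    letter, of the function that was maximal without it, and this value is
    centred given the other letters; the increments add up to at most [M].
    These facts turn the entropy bound into a differential inequality for the
    logarithm of the exponential moment of [M], which integrates ([herbst]) to

      log E exp (mu M) <= mu E M + mu^2 (n s2 + 2 E M) / (2 (1 - mu)),
      log E exp (- mu M) <= - mu E M + mu^2 (n s2 + 4 E M) / (2 (1 - mu)),

    see [mgf_upper] and [mgf_lower].  The second estimate is only needed, and
    only proved, for small [mu].  Indeed [T >= 0], so that [T < E Y - t] forces
    [t < E Y <= V' / 4], and the optimal [mu = t / (V' + t)] is below [1 / 5].
    By convexity of the exponential, averaging [Y] over the signs
    can only decrease its exponential moments, which is why one argument
    covers both choices of [T] ([finite_tail]).

    These estimates concern finite alphabets, where expectations are finite
    sums and no measurability question arises.  The general case follows by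
    approximation.  Finitely many functions of [F] are rounded towards [0] on a
    grid of step [1 / (2 N)] ([discretisation]); this makes the [X_i] independent
    letters of a finite alphabet, preserves the bound [1 / 2], does
    not increase second moments, and moves [Z] and [Y] by [O(n / N)].  The
    error disappears as [N] tends to infinity ([tail_limit]), and finite
    subclasses exhaust [F] ([finite_subclass_limit]).  The supremum over no
    function at all is [0], in which case the two events are empty. *)

Set Implicit Arguments.
Unset Strict Implicit.
Unset Printing Implicit Defensive.

Import Order.TTheory GRing.Theory Num.Theory.
Import numFieldNormedType.Exports.

Local Open Scope classical_set_scope.
Local Open Scope ring_scope.

(** * Elementary inequalities *)

Section ScalarInequalities.
Context {R : realType}.
Implicit Types x y u v : R.

Lemma nondecreasing_of_derivative (f df : R -> R) a b :
  a <= b -> (forall x, x \in `[a, b] -> is_derive x 1 f (df x)) ->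
  (forall x, x \in `[a, b] -> 0 <= df x) -> f a <= f b.
Proof.
move=> ab fd df0.
have fd' x : x \in `]a, b[ -> is_derive x 1 f (df x).
  by move=> xab; apply: fd; apply: subset_itvW xab.
have fc : {within `[a, b], continuous f}.
  by apply: derivable_within_continuous => x xab; have [] := fd x xab.
have [c cab E] := MVT_segment ab fd' fc.
by rewrite -subr_ge0 E mulr_ge0 ?subr_ge0 ?df0.
Qed.

Lemma mul_ln_div_ge x y : 0 < x -> 0 < y -> x - y <= x * ln (x / y).
Proof.
move=> x0 y0.
have /le_ln1Dx : -1 < y / x - 1 by rewrite ltrBrDr addrC subrr divr_gt0.
rewrite addrC subrK !ln_div ?posrE// => H.
have : x * (ln y - ln x) <= x * (y / x - 1) by rewrite ler_wpM2l// ltW.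
by rewrite [X in _ <= X]mulrBr mulrCA divff ?gt_eqF// !mulr1; lra.
Qed.

Lemma expR_ge_quadratic u : 0 <= u -> 1 + u + u ^+ 2 / 2 <= expR u.
Proof.
move=> u0; rewrite -subr_ge0.
pose f x : R := expR x - (1 + x + x ^+ 2 / 2).
have f0 : f 0 = 0 by rewrite /f expR0 expr0n /= mul0r !addr0 subrr.
rewrite -[X in X <= _]f0 -[X in _ <= X]/(f u).
apply: (@nondecreasing_of_derivative f (fun x => expR x - (1 + x))) => // x.
- move=> _; rewrite /f; apply: is_derive_eq.
  by rewrite /GRing.scale /= !mulr0; field.
- by move=> _; rewrite subr_ge0 expR_ge1Dx.
Qed.

Lemma expRN_le_quadratic u : 0 <= u -> expR (- u) <= 1 - u + u ^+ 2 / 2.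
Proof.
move=> u0; rewrite expRN -[leLHS]mul1r ler_pdivrMr ?expR_gt0//.
have q0 : 0 <= 1 - u + u ^+ 2 / 2 by nra.
apply: le_trans (ler_wpM2l q0 (expR_ge_quadratic u0)).
have -> : (1 - u + u ^+ 2 / 2) * (1 + u + u ^+ 2 / 2) = 1 + (u ^+ 2) ^+ 2 / 4.
  by field.
by have := sqr_ge0 (u ^+ 2); lra.
Qed.

Lemma expR_le_quadratic (u : R) : u <= 1 / 2 -> expR u <= 1 + u + 2 * u ^+ 2.
Proof.
move=> u2; have u1 : 0 < 1 - u by lra.
have : expR u * (1 - u) <= 1.
  rewrite -[X in _ <= X](expRxMexpNx_1 u) ler_wpM2l ?expR_ge0//.
  exact: expR_ge1Dx.
rewrite -ler_pdivlMr// => /le_trans; apply.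
rewrite ler_pdivrMr// -subr_ge0.
have -> : (1 + u + 2 * u ^+ 2) * (1 - u) - 1 = u ^+ 2 * (1 - 2 * u) by ring.
by rewrite mulr_ge0 ?sqr_ge0//; lra.
Qed.

(** With [u] the increment of the logarithm of a positive function when one
    letter is added, [expgap u] is what this letter contributes to the
    entropy, relative to the value of the function without it.  It vanishes to
    second order at [0], whence the quadratic bounds below. *)
Definition expgap u : R := 1 + (u - 1) * expR u.

Lemma expgap_le_pos u : 0 <= u -> expgap u <= u ^+ 2 / 2 * expR u.
Proof.
move=> u0; rewrite /expgap.
rewrite -lerBrDr -mulrBl -[leLHS](expRxMexpNx_1 u) mulrC ler_wpM2r ?expR_ge0//.
by have := expRN_le_quadratic u0; lra.
Qed.

Lemma expgap_le_neg u : u <= 0 -> expgap u <= u ^+ 2 / 2.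
Proof.
move=> u0; rewrite -subr_ge0.
pose f x : R := x ^+ 2 / 2 - (1 - (1 + x) * expR (- x)).
have f0 : f 0 = 0 by rewrite /f oppr0 expR0 expr0n /=; lra.
have -> : u ^+ 2 / 2 - expgap u = f (- u).
  by rewrite /f /expgap opprK sqrrN; ring.
rewrite -[X in X <= _]f0.
apply: (@nondecreasing_of_derivative f (fun x => x * (1 - expR (- x)))).
- by rewrite oppr_ge0.
- move=> x _; rewrite /f; apply: is_derive_eq.
  by rewrite /GRing.scale /= !mulr0; field.
- move=> x; rewrite in_itv /= => /andP[x0 _].
  by rewrite mulr_ge0// subr_ge0 expR_le1 oppr_le0.
Qed.

Lemma ler_gamma_tail (t v v' : R) : 0 < t -> 0 <= v -> v <= v' ->
  expR (- (t ^+ 2 / (2 * v + 2 * t))) <= expR (- (t ^+ 2 / (2 * v' + 2 * t))).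
Proof.
move=> t0 v0 vv'; rewrite ler_expR lerN2; apply: ler_wpM2l; first exact: sqr_ge0.
by rewrite lef_pV2 ?posrE; lra.
Qed.

End ScalarInequalities.

(** * Entropy on finite product spaces *)

Section IteratedExpectation.
Context {R : realType} {B : finType}.
Variable q : B -> R.

(** Expectation over [n] independent letters of law [q].  The recursion on the
    letters, rather than a sum over tuples, makes every property of product
    measures an induction on [n]; functions of any number of letters have the
    same type, so a maximum of sums can be evaluated with a letter removed. *)
Fixpoint expect (n : nat) (h : seq B -> R) : R :=
  if n is m.+1 then \sum_b q b * expect m (fun s => h (b :: s)) else h [::].

Definition del (i : nat) (s : seq B) : seq B := take i s ++ drop i.+1 s.

Lemma eq_expect n h g :
  (forall s, size s = n -> h s = g s) -> expect n h = expect n g.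
Proof.
elim: n h g => [|n IH] h g hg /=; first exact: hg.
by apply: eq_bigr => b _; congr (_ * _); apply: IH => s sn; rewrite hg //= sn.
Qed.

Lemma expectD n h g :
  expect n (fun s => h s + g s) = expect n h + expect n g.
Proof.
elim: n h g => [//|n IH] h g /=; rewrite -big_split /=.
by apply: eq_bigr => b _; rewrite IH mulrDr.
Qed.

Lemma expectZ n c h : expect n (fun s => c * h s) = c * expect n h.
Proof.
elim: n h => [//|n IH] h /=; rewrite mulr_sumr.
by apply: eq_bigr => b _; rewrite IH mulrCA.
Qed.

Lemma expectZr n c h : expect n (fun s => h s * c) = expect n h * c.
Proof. by rewrite mulrC -expectZ; apply: eq_expect => s _; rewrite mulrC. Qed.

Lemma expectN n h : expect n (fun s => - h s) = - expect n h.
Proof.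
by rewrite -mulN1r -expectZ; apply: eq_expect => s _; rewrite mulN1r.
Qed.

Lemma expectB n h g :
  expect n (fun s => h s - g s) = expect n h - expect n g.
Proof. by rewrite expectD expectN. Qed.

Lemma expect_sum (I : Type) (r : seq I) n (h : I -> seq B -> R) :
  expect n (fun s => \sum_(i <- r) h i s) = \sum_(i <- r) expect n (h i).
Proof.
elim: n h => [//|n IH] h /=; rewrite exchange_big /=.
by apply: eq_bigr => b _; rewrite IH mulr_sumr.
Qed.

Hypothesis q_ge0 : forall b, 0 <= q b.
Hypothesis q_sum1 : \sum_b q b = 1.

Lemma le_expect n h g :
  (forall s, size s = n -> h s <= g s) -> expect n h <= expect n g.
Proof.
elim: n h g => [|n IH] h g hg /=; first exact: hg.
apply: ler_sum => b _; apply: ler_wpM2l => //.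
by apply: IH => s sn; rewrite hg //= sn.
Qed.

Lemma expect_cst n c : expect n (fun=> c) = c.
Proof.
by elim: n => [//|n IH] /=; rewrite IH -mulr_suml q_sum1 mul1r.
Qed.

Lemma expect_ge0 n h : (forall s, size s = n -> 0 <= h s) -> 0 <= expect n h.
Proof. by move=> h0; rewrite -(expect_cst n 0); exact: le_expect. Qed.

Lemma expect_gt0 n h : (forall s, 0 < h s) -> 0 < expect n h.
Proof.
elim: n h => [|n IH] h h0 /=; first exact: h0.
rewrite lt_neqAle sumr_ge0 ?andbT; last first.
  by move=> b _; rewrite mulr_ge0// ltW// IH.
apply/eqP => /esym/eqP; rewrite psumr_eq0; last first.
  by move=> b _; rewrite mulr_ge0// ltW// IH.
move/allP => q0; move: q_sum1; rewrite big1 => [/eqP|b _].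
  by rewrite eq_sym oner_eq0.
have /q0 : b \in index_enum B by rewrite mem_index_enum.
by rewrite /= mulf_eq0 [X in _ || X]gt_eqF ?orbF ?IH// => /eqP.
Qed.

(** Fubini's theorem for the [i]-th letter: it is independent of the
    sequence of the other ones. *)
Lemma expect_del n i (psi : seq B -> B -> R) b0 : (i < n.+1)%N ->
  expect n.+1 (fun s => psi (del i s) (nth b0 s i)) =
  expect n (fun s => \sum_b q b * psi s b).
Proof.
elim: n i psi => [|n IH] [|i] psi in0.
- by apply: eq_bigr => b _.
- by [].
- rewrite (expect_sum _ n.+1 (fun b s => q b * psi s b)).
  rewrite -[LHS]/(\sum_b q b * expect n.+1 (fun s => psi (del 0 (b :: s)) b)).
  apply: eq_bigr => b _; rewrite (expectZ n.+1) /del; congr (_ * _).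
- transitivity (\sum_b q b *
     expect n.+1 (fun s => psi (b :: del i s) (nth b0 s i))).
    by apply: eq_bigr => b _.
  by apply: eq_bigr => b _; rewrite (IH i (fun s => psi (b :: s))).
Qed.

(** The log-sum inequality.  It follows from [x * ln (x / y) >= x - y],
    applied with [y] the multiple of [g s] that has the same expectation as
    [h]. *)
Lemma log_sum n h g : (forall s, 0 < h s) -> (forall s, 0 < g s) ->
  expect n h * ln (expect n h / expect n g) <=
  expect n (fun s => h s * ln (h s / g s)).
Proof.
move=> h0 g0.
have H0 := expect_gt0 n h0; have G0 := expect_gt0 n g0.
set c := expect n h / expect n g.
have c0 : 0 < c by rewrite divr_gt0.
rewrite -subr_ge0 -expectZr -expectB.
apply: le_trans (_ : expect n (fun s => h s - c * g s) <= _).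
  by rewrite expectB expectZ /c divfK ?gt_eqF// subrr.
apply: le_expect => s _; rewrite -mulrBr -ln_div ?posrE ?divr_gt0//.
have -> : h s / g s / c = h s / (c * g s) by rewrite (invfM c) mulrA mulrAC.
by apply: mul_ln_div_ge => //; rewrite mulr_gt0.
Qed.

(** Subadditivity of entropy, combined with its variational formula: the
    conditional entropy of [h] given all letters but one is the minimum of
    [E (h ln (h / c) - h + c)] over the constants [c], and [c] is chosen as
    the value of [h] itself on the sequence with that letter removed.  In the
    induction the entropy of [h] is the mean over the first letter of the
    entropies of the sections, plus the entropy of the expectations of the
    sections; the log-sum inequality bounds the latter. *)
Lemma entropy_tensorization n h : (forall s, 0 < h s) ->
  expect n (fun s => h s * ln (h s)) - expect n h * ln (expect n h) <=
  \sum_(i < n) expect n (fun s =>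
     h s * ln (h s / h (del i s)) - h s + h (del i s)).
Proof.
elim: n h => [|n IH] h h0; first by rewrite big_ord0 /= subrr.
rewrite big_ord_recl /=.
under [X in _ <= _ + X]eq_bigr => i _ do under eq_bigr => b _ do
  rewrite /del /= -/(del i _).
rewrite [X in _ <= _ + X]exchange_big /=.
under [X in _ <= X + _]eq_bigr => b _ do
  (under eq_expect => s _ do rewrite /del /= drop0).
set H := \sum_b q b * expect n (fun s => h (b :: s)).
set G := expect n h.
have G0 : 0 < G by exact: expect_gt0.
have H0 : 0 < H by exact: (@expect_gt0 n.+1 h).
have e0 b : 0 < expect n (fun s => h (b :: s)) by apply: expect_gt0.
have step b : expect n (fun s => h (b :: s) * ln (h (b :: s))) <=
    expect n (fun s => h (b :: s)) * ln G - G + expect n (fun s => h (b :: s))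
  + (expect n (fun s =>
       h (b :: s) * ln (h (b :: s) / h s) - h (b :: s) + h s) +
     \sum_(i < n) expect n (fun s =>
       h (b :: s) * ln (h (b :: s) / h (b :: del i s)) - h (b :: s) +
       h (b :: del i s))).
  have := IH _ (fun s => h0 (b :: s)).
  have := @log_sum n (fun s => h (b :: s)) h (fun s => h0 _) h0.
  rewrite ln_div ?posrE// expectD expectB -/G.
  by move=> H1 H2; nra.
have := @ler_sum _ _ (index_enum B) xpredT _ _
  (fun b _ => ler_wpM2l (q_ge0 b) (step b)).
under [X in _ <= X -> _]eq_bigr => b _ do
  rewrite mulrDr mulrDr mulrBr mulrA mulrDr mulr_sumr.
rewrite !big_split /= sumrN -!mulr_suml q_sum1 mul1r -/H.
have := mul_ln_div_ge H0 G0; rewrite ln_div ?posrE// mulrBr.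
move=> H1 H2.
by lra.
Qed.

End IteratedExpectation.

(** * From entropy to exponential moments *)

Section Herbst.
Context {R : realType} {B : finType}.
Variable q : B -> R.
Hypothesis q_ge0 : forall b, 0 <= q b.
Hypothesis q_sum1 : \sum_b q b = 1.

Lemma is_derive_expect n (f : R -> seq B -> R) (df : seq B -> R) (x : R) :
  (forall s, is_derive x 1 (fun y : R => f y s : R) (df s)) ->
  is_derive x 1 (fun y : R => expect q n (f y)) (expect q n df).
Proof.
elim: n f df => [|n IH] f df fd /=; first exact: fd.
elim: (index_enum B) => [|b r IHr].
  rewrite big_nil (_ : (fun y => _) = cst 0); first exact: is_derive_cst.
  by apply/funext => y; rewrite big_nil.
rewrite big_cons (_ : (fun y => _) =
  (q b *: (fun y => expect q n (fun s => f y (b :: s)))) +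
  (fun y => \sum_(j <- r) q j * expect q n (fun s => f y (j :: s)))); last first.
  by apply/funext => y; rewrite big_cons.
have d := IH (fun y s => f y (b :: s)) _ (fun s => fd (b :: s)).
exact: is_deriveD.
Qed.

(** Herbst's argument.  With [psi x = ln E exp (x N)], the hypothesis divided
    by [x ^+ 2 * E exp (x N)] says that [psi x * (x^-1 - kappa) - rho x] has a
    nonpositive derivative, and this quantity is at most [E N] in the limit at
    [0].  The constant [kappa] absorbs an entropy bound that involves the
    derivative of [psi] itself. *)
Lemma herbst n (N : seq B -> R) (C kappa c : R) (rho drho : R -> R) :
  (forall s, size s = n -> `|N s| <= C) ->
  0 <= kappa <= 1 -> c <= 1 ->
  (forall x : R, 0 < x <= c -> is_derive x 1 rho (drho x)) ->
  (forall x : R, 0 < x <= c -> 0 <= rho x) ->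
  (forall x : R, 0 < x <= c ->
     (x - kappa * x ^+ 2) * expect q n (fun s => expR (x * N s) * N s)
     - expect q n (fun s => expR (x * N s)) *
       ln (expect q n (fun s => expR (x * N s)))
     <= x ^+ 2 * drho x * expect q n (fun s => expR (x * N s))) ->
  forall x : R, 0 < x <= c ->
  ln (expect q n (fun s => expR (x * N s))) * (x^-1 - kappa) <=
  expect q n N + rho x.
Proof.
move=> NC /andP[k0 k1] c1 rhod rho0 ent x /andP[x0 xc].
pose F y := expect q n (fun s => expR (y * N s)).
pose dF y := expect q n (fun s => expR (y * N s) * N s).
have F0 y : 0 < F y by apply: expect_gt0 => // s; exact: expR_gt0.
have Fd (y : R) : is_derive y 1 F (dF y).
  apply: is_derive_expect => s.
  have Hl : is_derive y 1 ( *%R^~ (N s)) (N s).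
    rewrite (_ : *%R^~ (N s) = N s *: id).
      by apply: is_derive_eq; rewrite /GRing.scale /= mulr1.
    by apply/funext => z; rewrite /= mulrC.
  exact: (@is_derive1_comp _ expR ( *%R^~ (N s))).
pose Q y := ln (F y) * (y^-1 - kappa) - rho y.
pose dQ y := (dF y / F y) * (y^-1 - kappa) - ln (F y) / y ^+ 2 - drho y.
have Qd (y : R) : 0 < y <= c -> is_derive y 1 Q (dQ y).
  move=> /andP[y0 yc].
  have d1 : is_derive y 1 (@ln R \o F) ((F y)^-1 * dF y).
    by apply: is_derive1_comp; exact: is_derive1_ln.
  have d2 : is_derive y 1 (fun z : R => z^-1) (- y ^- 2).
    have : is_derive y 1 (fun z : R => z^-1) (- (id y) ^- 2 *: 1).
      by apply: is_deriveV => //; rewrite gt_eqF.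
    by rewrite /GRing.scale /= mulr1.
  have d3 : is_derive y 1 rho (drho y) by apply: rhod; rewrite y0.
  rewrite (_ : Q = (@ln R \o F) * ((fun z : R => z^-1) - cst kappa) - rho) //.
  apply: is_derive_eq.
  rewrite /dQ /GRing.scale /=.
  rewrite -[X in _ + X * _ - _]/(y^-1 - kappa).
 by field; rewrite !gt_eqF.
have dQ0 (y : R) : 0 < y <= c -> dQ y <= 0.
  move=> /[dup] yc /ent; rewrite -/(F y) -/(dF y) => H.
  have y0 : 0 < y by case/andP: yc.
  have -> : dQ y = ((y - kappa * y ^+ 2) * dF y - F y * ln (F y)
                     - y ^+ 2 * drho y * F y) / (y ^+ 2 * F y).
    by rewrite /dQ; field; rewrite !gt_eqF.
  by rewrite ler_pdivrMr ?mul0r ?subr_le0 ?mulr_gt0 ?exprn_gt0.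
have Qmono (e : R) : 0 < e <= x -> Q x <= Q e.
  move=> /andP[e0 ex]; rewrite -lerN2.
  apply: (@nondecreasing_of_derivative _ (fun z => - Q z) (fun z => - dQ z)) => //.
  - move=> z; rewrite in_itv /= => /andP[ez zx].
    apply: (@is_deriveN _ _ _ Q); apply: Qd.
    by rewrite (lt_le_trans e0 ez) (le_trans zx xc).
  - move=> z; rewrite in_itv /= => /andP[ez zx].
    by rewrite oppr_ge0 dQ0// (lt_le_trans e0 ez) (le_trans zx xc).
have C0 : 0 <= `|C| by [].
pose C' := 2 * C ^+ 2 + `|expect q n N| + 1.
have C'0 : 0 < C'.
  by have := sqr_ge0 C; have := normr_ge0 (expect q n N); rewrite /C'; lra.
rewrite -lerBlDr -/(F x) -/(Q x).
apply/ler_addgt0Pr => e e0.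
(* [d] is small enough for [expR_le_quadratic] to apply to [d * N s], and for
   the second-order error [d * C'] to be at most [e]. *)
pose d := Num.min x (Num.min (2 * (`|C| + 1))^-1 (e / C')).
have d0 : 0 < d.
  rewrite !lt_min x0 divr_gt0// invr_gt0 andbT /=.
  by apply: mulr_gt0 => //; lra.
have dx : d <= x by rewrite ge_min lexx.
have dC : d * (2 * (`|C| + 1)) <= 1.
  rewrite -ler_pdivlMr; last by apply: mulr_gt0 => //; lra.
  by rewrite div1r !ge_min lexx orbT.
have de : d * C' <= e.
  by rewrite -ler_pdivlMr// !ge_min lexx !orbT.
have d1 : d <= 1 by lra.
apply: (le_trans (Qmono d _)); first by rewrite d0.
have lnF : ln (F d) <= d * expect q n N + 2 * d ^+ 2 * C ^+ 2.
  have : F d <= 1 + (d * expect q n N + 2 * d ^+ 2 * C ^+ 2).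
    rewrite -[X in X + _](expect_cst q_sum1 n).
    rewrite -expectZ -[X in _ + (_ + X)](expect_cst q_sum1 n) -!expectD.
    apply: le_expect => // s sn.
    have NsC := NC _ sn.
    have Cge : `|N s| <= `|C| by rewrite (le_trans NsC)// ler_norm.
    have dN : d * N s <= 1 / 2.
      have : N s <= `|C| by rewrite (le_trans (ler_norm _)).
      by move=> ?; nra.
    apply: (le_trans (expR_le_quadratic dN)).
    have : N s ^+ 2 <= C ^+ 2.
      rewrite -real_normK ?num_real// -[leRHS]real_normK ?num_real//.
      by rewrite lerXn2r ?nnegrE.
    move=> /(ler_wpM2l (sqr_ge0 d)); rewrite exprMn; lra.
  move=> Fle; set X := d * _ + _ in Fle *.
  have X1 : -1 < X by have := F0 d; lra.
  apply: le_trans (le_ln1Dx X1); rewrite ler_ln ?posrE//.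
  by rewrite (lt_le_trans (F0 d)).
have dk : 0 <= d^-1 - kappa.
  by rewrite subr_ge0 (le_trans k1)// invf_ge1.
have : 0 <= rho d by apply: rho0; rewrite d0 (le_trans dx).
have := ler_wpM2r dk lnF; rewrite /Q.
have -> : (d * expect q n N + 2 * d ^+ 2 * C ^+ 2) * (d^-1 - kappa) =
  (expect q n N + 2 * d * C ^+ 2) * (1 - kappa * d).
  by field; rewrite gt_eqF.
have := ler_norm (expect q n N); have := ler_norm (- expect q n N).
rewrite normrN => H1 H2.
have := sqr_ge0 C; move: de; rewrite /C'.
set a := `|_| in H1 H2 *; set E := expect q n N in H1 H2 *.
set CC := C ^+ 2 => de CC0 HH rd.
have kd : 0 <= kappa * d <= d.
  by apply/andP; split; [exact: mulr_ge0 (ltW d0)|exact: ler_piMl (ltW d0) k1].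
have a0 : 0 <= a by rewrite /a.
have : (E + 2 * d * CC) * (1 - kappa * d) <= E + d * (2 * CC + a).
  case/andP: kd => kd0 kd1.
  have := mulr_ge0 kd0 (mulr_ge0 (mulr_ge0 (ler0n R 2) (ltW d0)) CC0).
  have : (kappa * d) * (- E) <= d * a.
    by apply: le_trans (_ : kappa * d * a <= _); [exact: ler_wpM2l|exact: ler_wpM2r].
  by move=> ? ?; lra.
by move=> ?; lra.
Qed.

End Herbst.

(** * Concentration of the maximum of centred sums *)

Section PointwiseBounds.
Context {R : realType}.
Implicit Types mu tau g d : R.

(** Here [d] is the increment of the maximum when a letter is added and [g]
    the value at this letter of the function that was maximal before.  In
    expectation [g] vanishes, [g ^+ 2] produces the variance, and the increments
    [d] add up to at most the maximum.  The right-hand side decreases in [g],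
    as [g <= 1], so only [g = d] needs to be checked. *)
Lemma expgap_upper mu g d : 0 <= mu -> g <= d -> d <= 1 ->
  expgap (mu * d) <= mu ^+ 2 / 2 * (g ^+ 2 - 2 * g + 2 * (d * expR (mu * d))).
Proof.
move=> mu0 gd d1.
have gg : d ^+ 2 - 2 * d <= g ^+ 2 - 2 * g.
  rewrite -subr_ge0 (_ : _ - _ = (d - g) * (2 - d - g)); last by ring.
  by rewrite mulr_ge0//; lra.
apply: (@le_trans _ _ (mu ^+ 2 / 2 * (d ^+ 2 - 2 * d + 2 * (d * expR (mu * d)))));
  last first.
  by apply: ler_wpM2l; [rewrite divr_ge0 ?sqr_ge0|rewrite lerD2r].
have [d0|d0] := leP 0 d.
- have u0 : 0 <= mu * d by rewrite mulr_ge0.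
  apply: le_trans (expgap_le_pos u0) _.
  have e1 : 1 <= expR (mu * d) by rewrite -expR0 ler_expR.
  rewrite exprMn.
  rewrite (_ : _ / 2 * _ = mu ^+ 2 / 2 * (d ^+ 2 * expR (mu * d))); last by ring.
  apply: ler_wpM2l; first by rewrite divr_ge0 ?sqr_ge0.
  rewrite -subr_ge0 (_ : _ - _ = (expR (mu * d) - 1) * (d * (2 - d))); last by ring.
  by rewrite mulr_ge0 ?subr_ge0// mulr_ge0//; lra.
- have u0 : mu * d <= 0 by rewrite mulr_ge0_le0// ltW.
  apply: le_trans (expgap_le_neg u0) _.
  have e1 : expR (mu * d) <= 1 by rewrite -expR0 ler_expR.
  rewrite exprMn mulrAC; apply: ler_wpM2l; first by rewrite divr_ge0 ?sqr_ge0.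
  rewrite -subr_ge0 (_ : _ - _ = (1 - expR (mu * d)) * (- d * 2)); last by ring.
  by rewrite mulr_ge0 ?subr_ge0//; lra.
Qed.

(** The analogue for [- mu].  The denominator [(1 - mu) ^+ 2] leaves a
    third-order margin, which pays for the two third-order errors: that
    [d * expR (- (mu * d))] is at most [d], and that the exponential moment may
    decrease when a letter is added, which accounts for [tau * d]. *)
Lemma expgap_lower mu tau g d :
  0 <= mu <= 2 / 5 -> 0 <= tau <= mu / 4 -> - (1 / 2) <= g -> g <= d ->
  d <= 1 / 2 ->
  expgap (- (mu * d)) <= mu ^+ 2 / (2 * (1 - mu) ^+ 2) *
    (g ^+ 2 - g - tau * d + (1 + tau) * (d * expR (- (mu * d)))).
Proof.
move=> /andP[mu0 mu1] /andP[t0 t1] g1 gd d1.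
have m1 : 0 < 1 - mu by lra.
have w0 : 0 <= mu ^+ 2 / (2 * (1 - mu) ^+ 2).
  by apply: divr_ge0; [exact: sqr_ge0|apply: mulr_ge0 => //; exact: sqr_ge0].
have gg : d ^+ 2 - d <= g ^+ 2 - g.
  rewrite -subr_ge0 (_ : _ - _ = (d - g) * (1 - d - g)); last by ring.
  by rewrite mulr_ge0//; lra.
apply: (@le_trans _ _ (mu ^+ 2 / (2 * (1 - mu) ^+ 2) *
    (d ^+ 2 - (1 + tau) * (d * (1 - expR (- (mu * d))))))); last first.
  apply: ler_wpM2l => //; rewrite -subr_ge0.
  rewrite (_ : _ - _ = g ^+ 2 - g - (d ^+ 2 - d)); last by ring.
  by rewrite subr_ge0.
rewrite mulrAC ler_pdivlMr; last by rewrite mulr_gt0// exprn_gt0.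
have [d0|d0] := leP 0 d.
- have u0 : - (mu * d) <= 0 by rewrite oppr_le0 mulr_ge0.
  have H1 := expgap_le_neg u0.
  have H2 : 1 - expR (- (mu * d)) <= mu * d.
    by have := expR_ge1Dx (- (mu * d)); lra.
  apply: le_trans (ler_wpM2r _ H1) _; first by apply: mulr_ge0 => //; exact: sqr_ge0.
  rewrite sqrrN exprMn.
  rewrite (_ : _ / 2 * _ = mu ^+ 2 * (d ^+ 2 * (1 - mu) ^+ 2)); last by field.
  apply: ler_wpM2l; first exact: sqr_ge0.
  have : (1 + tau) * (d * (1 - expR (- (mu * d)))) <= (1 + tau) * (d * (mu * d)).
    by do 2?[apply: ler_wpM2l => //]; lra.
  have : d ^+ 2 * ((1 + tau) * mu) <= d ^+ 2 * (1 - (1 - mu) ^+ 2).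
    by apply: ler_wpM2l; [exact: sqr_ge0|nra].
  by lra.
- pose c := - d; have -> : d = - c by rewrite /c opprK.
  have c0 : 0 < c by rewrite /c; lra.
  have c1 : c <= 1 / 2 by rewrite /c; lra.
  rewrite mulrN opprK sqrrN.
  set u := mu * c.
  have u0 : 0 <= u by rewrite /u mulr_ge0// ltW.
  have u1 : u <= mu / 2 by rewrite /u; nra.
  have e1 : expR u * (1 - u) <= 1.
    rewrite -[X in _ <= X](expRxMexpNx_1 u) ler_wpM2l ?expR_ge0//.
    exact: expR_ge1Dx.
  have uu : 0 < 1 - u by lra.
  have H1 := expgap_le_pos u0.
  have H2 : expR u <= (1 - u)^-1 by rewrite -div1r ler_pdivlMr.
  have H3 : expR u - 1 <= u / (1 - u).
    rewrite ler_pdivlMr// mulrBl; lra.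
  apply: le_trans (ler_wpM2r _ H1) _; first by apply: mulr_ge0 => //; exact: sqr_ge0.
  apply: (@le_trans _ _ (mu ^+ 2 * (c ^+ 2 * (1 - mu) ^+ 2 / (1 - u)))).
    have -> : u ^+ 2 / 2 * expR u * (2 * (1 - mu) ^+ 2) =
       mu ^+ 2 * (c ^+ 2 * (1 - mu) ^+ 2 * expR u) by rewrite /u; field.
    apply: ler_wpM2l; first exact: sqr_ge0.
    by apply: ler_wpM2l => //; apply: mulr_ge0; exact: sqr_ge0.
  apply: ler_wpM2l; first exact: sqr_ge0.
  have : (1 + tau) * (c * (expR u - 1)) <= (1 + tau) * (c * (u / (1 - u))).
    by do 2?[apply: ler_wpM2l => //]; lra.
  have : c ^+ 2 * (1 - mu) ^+ 2 / (1 - u) <=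
     c ^+ 2 - (1 + tau) * (c * (u / (1 - u))).
    rewrite ler_pdivrMr//.
    have -> : (c ^+ 2 - (1 + tau) * (c * (u / (1 - u)))) * (1 - u) =
       c ^+ 2 * (1 - u) - (1 + tau) * (c * u) by field; rewrite gt_eqF.
    have -> : c ^+ 2 * (1 - u) - (1 + tau) * (c * u) =
       c ^+ 2 * (1 - u - (1 + tau) * mu) by rewrite /u; ring.
    by apply: ler_wpM2l; [exact: sqr_ge0|nra].
  by lra.
Qed.

End PointwiseBounds.

Section Maximum.
Context {R : realType} {B K : finType}.
Variables (u : K -> B -> R) (k0 : K) (b0 : B).

Definition sumk (k : K) (s : seq B) : R := \sum_(b <- s) u k b.
Definition argk (s : seq B) : K := [arg max_(k > k0) sumk k s]%O.
Definition maxk (s : seq B) : R := sumk (argk s) s.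

Lemma maxk_ge k s : sumk k s <= maxk s.
Proof. by rewrite /maxk /argk; case: arg_maxP => // j _ /(_ k); apply. Qed.

Lemma sumk_del k i s : (i < size s)%N ->
  sumk k s = u k (nth b0 s i) + sumk k (del i s).
Proof.
move=> si; rewrite /sumk /del -[in LHS](cat_take_drop i s) (drop_nth b0 si).
by rewrite !big_cat big_cons /= addrCA.
Qed.

Definition incr (i : nat) (s : seq B) : R := maxk s - maxk (del i s).

Lemma incr_ge i s : (i < size s)%N ->
  u (argk (del i s)) (nth b0 s i) <= incr i s.
Proof.
move=> si; rewrite lerBrDr.
have := maxk_ge (argk (del i s)) s.
by rewrite (sumk_del _ si).
Qed.

Lemma incr_le i s : (i < size s)%N -> incr i s <= u (argk s) (nth b0 s i).
Proof.
move=> si; rewrite lerBlDr {1}/maxk (sumk_del _ si) lerD2l; exact: maxk_ge.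
Qed.

Lemma sum_incr_le s : \sum_(i < size s) incr i s <= maxk s.
Proof.
apply: (@le_trans _ _ (\sum_(i < size s) u (argk s) (nth b0 s i))).
  by apply: ler_sum => i _; exact: incr_le.
by rewrite /maxk /sumk (big_nth b0) big_mkord.
Qed.

Lemma norm_maxk_le c s : (forall k b, `|u k b| <= c) ->
  `|maxk s| <= c * (size s)%:R.
Proof.
move=> uc; apply: (le_trans (ler_norm_sum _ _ _)).
apply: (le_trans (ler_sum _ (fun b _ => uc (argk s) b))).
by rewrite big_const_seq count_predT iter_addr_0 mulr_natr.
Qed.

End Maximum.

Section Concentration.
Context {R : realType} {B K : finType}.
Variables (q : B -> R) (u : K -> B -> R) (k0 : K) (s2 : R).
Hypothesis q_ge0 : forall b, 0 <= q b.
Hypothesis q_sum1 : \sum_b q b = 1.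
Hypothesis u_centered : forall k, \sum_b q b * u k b = 0.
Hypothesis u_var : forall k, \sum_b q b * u k b ^+ 2 <= s2.

Let M := maxk u k0.
Let D i s := M s - M (del i s).

Lemma prob_inhabited : {b : B | true}.
Proof.
case: (pickP (@predT B)) => [b _|B0]; first by exists b.
by exfalso; move: q_sum1; rewrite big_pred0// => /eqP; rewrite eq_sym oner_eq0.
Qed.

Let b0 := sval prob_inhabited.

Lemma expect_sumk n k : expect q n (sumk u k) = 0.
Proof.
elim: n => [|n IH] /=; first by rewrite /sumk big_nil.
rewrite -[RHS](u_centered k); apply: eq_bigr => b _; congr (_ * _).
under eq_expect => s _ do rewrite /sumk big_cons -/(sumk u k s).
by rewrite expectD IH addr0 expect_cst.
Qed.

Lemma expect_maxk_ge0 n : 0 <= expect q n M.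
Proof.
rewrite -(expect_sumk n k0); apply: le_expect => // s _; exact: maxk_ge.
Qed.

Let g i s := u (argk u k0 (del i s)) (nth b0 s i).

(** The function that is maximal on the other letters does not depend on the
    [i]-th one, so its value there is centred given the others. *)
Lemma expect_centered n i (phi : seq B -> R) (a : R) : (i < n)%N ->
  (forall s, 0 <= phi s) ->
  expect q n (fun s => phi (del i s) * (g i s ^+ 2 - a * g i s)) <=
  s2 * expect q n (fun s => phi (del i s)).
Proof.
case: n => // n i_n phi0.
rewrite (expect_del _ (fun s b => phi s *
  (u (argk u k0 s) b ^+ 2 - a * u (argk u k0 s) b)) b0 i_n).
rewrite (expect_del _ (fun s b => phi s) b0 i_n) -expectZ.
apply: le_expect => // s _.
rewrite -mulr_suml q_sum1 mul1r mulrC.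
under eq_bigr => b _ do rewrite mulrCA mulrBr [q b * (a * _)]mulrCA.
rewrite -mulr_sumr; apply: ler_wpM2l => //.
by rewrite sumrB -mulr_sumr u_centered mulr0 subr0.
Qed.

Lemma entropy_gap n (mu : R) :
  expect q n (fun s => expR (mu * M s) * (mu * M s))
  - expect q n (fun s => expR (mu * M s)) *
    ln (expect q n (fun s => expR (mu * M s))) <=
  \sum_(i < n) expect q n (fun s =>
     expR (mu * M (del i s)) * expgap (mu * D i s)).
Proof.
have := @entropy_tensorization _ _ q q_ge0 q_sum1 n (fun s => expR (mu * M s))
  (fun s => expR_gt0 _).
under eq_expect => s _ do rewrite expRK.
move=> /le_trans; apply; apply: ler_sum => i _; apply: le_expect => // s _.
rewrite -expRB expRK /expgap /D [mu * (_ - _)]mulrBr.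
set a := mu * M s; set b := mu * M (del i s).
have -> : expR a = expR b * expR (a - b) by rewrite -expRD addrC subrK.
by rewrite le_eqVlt; apply/orP; left; apply/eqP; ring.
Qed.

Lemma entropy_upper n (mu : R) : 0 <= mu -> (forall k b, u k b <= 1) ->
  expect q n (fun s => expR (mu * M s) * (mu * M s))
  - expect q n (fun s => expR (mu * M s)) *
    ln (expect q n (fun s => expR (mu * M s))) <=
  mu ^+ 2 / 2 * (n%:R * s2 * expect q n (fun s => expR (mu * M s))
                 + 2 * expect q n (fun s => expR (mu * M s) * M s)).
Proof.
move=> mu0 u1; apply: le_trans (entropy_gap n mu) _.
set F := expect q n (fun s => expR (mu * M s)).
have s20 : 0 <= s2.
  by apply: le_trans (u_var k0); apply: sumr_ge0 => b _; rewrite mulr_ge0 ?sqr_ge0.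
have step (i : 'I_n) : expect q n (fun s =>
     expR (mu * M (del i s)) * expgap (mu * D i s)) <=
  mu ^+ 2 / 2 * (s2 * F + 2 * expect q n (fun s => expR (mu * M s) * D i s)).
  apply: (@le_trans _ _ (mu ^+ 2 / 2 *
    (expect q n (fun s => expR (mu * M (del i s)) * (g i s ^+ 2 - 2 * g i s))
     + 2 * expect q n (fun s => expR (mu * M s) * D i s)))).
    rewrite -expectZ -expectD -expectZ; apply: le_expect => // s sn.
    have si : (i < size s)%N by rewrite sn.
    have := @expgap_upper _ mu (g i s) (D i s) mu0 (incr_ge _ _ _ si)
      (le_trans (incr_le _ _ b0 si) (u1 _ _)).
    move=> /(ler_wpM2l (expR_ge0 (mu * M (del i s)))) /le_trans; apply.
    rewrite (_ : expR (mu * M s) = expR (mu * M (del i s)) * expR (mu * D i s)).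
      by rewrite le_eqVlt; apply/orP; left; apply/eqP; ring.
    by rewrite -expRD -mulrDr addrC subrK.
  apply: ler_wpM2l; first by rewrite divr_ge0 ?sqr_ge0.
  rewrite lerD2r.
  apply: le_trans (expect_centered 2 (ltn_ord i) (fun s => expR_ge0 (mu * M s))) _.
  apply: ler_wpM2l => //.
  case: n i @F => // n i F.
  (* Adding a letter does not decrease the exponential moment: the function
     that was maximal before gains a centred value. *)
  apply: (@le_trans _ _ (expect q n.+1 (fun s =>
     expR (mu * M (del i s)) * (1 + mu * g i s)))).
    rewrite (expect_del _ (fun s b => expR (mu * M s)) b0 (ltn_ord i)).
    rewrite (expect_del _ (fun s b => expR (mu * M s) *
      (1 + mu * u (argk u k0 s) b)) b0 (ltn_ord i)).
    apply: le_expect => // s _.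
    under [X in _ <= X]eq_bigr => b _ do rewrite mulrCA.
    rewrite -mulr_suml q_sum1 mul1r -mulr_sumr.
    under eq_bigr => b _ do rewrite mulrDr mulr1 mulrCA.
    by rewrite big_split /= q_sum1 -mulr_sumr u_centered mulr0 addr0 mulr1.
  apply: le_expect => // s sn.
  have si : (i < size s)%N by rewrite sn.
  rewrite (_ : expR (mu * M s) = expR (mu * M (del i s)) * expR (mu * D i s)).
    apply: ler_wpM2l; first exact: expR_ge0.
    apply: le_trans (expR_ge1Dx _); rewrite lerD2l; apply: ler_wpM2l => //.
    exact: incr_ge.
  by rewrite -expRD -mulrDr addrC subrK.
apply: (le_trans (ler_sum _ (fun i _ => step i))).
rewrite -mulr_sumr; apply: ler_wpM2l; first by rewrite divr_ge0 ?sqr_ge0.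
rewrite big_split /= sumr_const card_ord -mulr_sumr -mulrA [n%:R * _]mulr_natl.
rewrite lerD2l; apply: ler_wpM2l => //.
rewrite -expect_sum; apply: le_expect => // s sn.
rewrite -mulr_sumr; apply: ler_wpM2l; first exact: expR_ge0.
by have := sum_incr_le u k0 b0 s; rewrite sn.
Qed.

Lemma entropy_lower n (mu : R) : 0 <= mu <= 2 / 5 ->
  (forall k b, `|u k b| <= 1 / 2) -> s2 <= 1 / 4 ->
  expect q n (fun s => expR (- mu * M s) * (- mu * M s))
  - expect q n (fun s => expR (- mu * M s)) *
    ln (expect q n (fun s => expR (- mu * M s))) <=
  mu ^+ 2 / (2 * (1 - mu) ^+ 2) * (n%:R * s2 + 4 * expect q n M) *
    expect q n (fun s => expR (- mu * M s)).
Proof.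
move=> /andP[mu0 mu1] u1 s21; apply: le_trans (entropy_gap n (- mu)) _.
set F := expect q n (fun s => expR (- mu * M s)).
set w := mu ^+ 2 / (2 * (1 - mu) ^+ 2).
have w0 : 0 <= w.
  by apply: divr_ge0; [exact: sqr_ge0|apply: mulr_ge0 => //; exact: sqr_ge0].
have s20 : 0 <= s2.
  by apply: le_trans (u_var k0); apply: sumr_ge0 => b _; rewrite mulr_ge0 ?sqr_ge0.
(* [s2 * expect q n (fun s => expR (- mu * M (del i s)))] exceeds
   [s2 * F] by at most [tau] times the mean weighted increment. *)
pose tau := mu * s2.
have tau0 : 0 <= tau <= mu / 4.
  by rewrite /tau mulr_ge0//=; apply: ler_wpM2l => //; lra.
have step (i : 'I_n) : expect q n (fun s =>
     expR (- mu * M (del i s)) * expgap (- mu * D i s)) <=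
  w * (s2 * F + (1 + tau) * expect q n (fun s => expR (- mu * M s) * D i s)).
  have Msplit s : expR (- mu * M s) =
      expR (- mu * M (del i s)) * expR (- (mu * D i s)).
    by rewrite -mulNr -expRD -mulrDr addrC subrK.
  apply: (@le_trans _ _ (w *
    (expect q n (fun s => expR (- mu * M (del i s)) * (g i s ^+ 2 - 1 * g i s))
     - tau * expect q n (fun s => expR (- mu * M (del i s)) * D i s)
     + (1 + tau) * expect q n (fun s => expR (- mu * M s) * D i s)))).
    rewrite -!expectZ -expectB -expectD -expectZ; apply: le_expect => // s sn.
    have si : (i < size s)%N by rewrite sn.
    have u1l k b : - (1 / 2) <= u k b by have := u1 k b; rewrite ler_norml => /andP[].
    have u1u k b : u k b <= 1 / 2 by have := u1 k b; rewrite ler_norml => /andP[].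
    have mu01 : 0 <= mu <= 2 / 5 by rewrite mu0.
    have := @expgap_lower _ mu tau (g i s) (D i s) mu01 tau0 (u1l _ _)
      (incr_ge _ _ _ si) (le_trans (incr_le _ _ b0 si) (u1u _ _)).
    move=> /(ler_wpM2l (expR_ge0 (- mu * M (del i s)))).
    rewrite -[- (mu * D i s)]mulNr => /le_trans; apply.
    rewrite (Msplit s) -/w -[- (mu * D i s)]mulNr.
    by rewrite le_eqVlt; apply/orP; left; apply/eqP; ring.
  apply: ler_wpM2l => //; rewrite lerD2r.
  have H := expect_centered 1 (ltn_ord i) (fun s => expR_ge0 (- mu * M s)).
  apply: (@le_trans _ _ (s2 * (expect q n (fun s => expR (- mu * M (del i s)))
     - mu * expect q n (fun s => expR (- mu * M (del i s)) * D i s)))).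
    by rewrite mulrBr [s2 * (mu * _)]mulrA [s2 * mu]mulrC -/tau lerB.
  apply: ler_wpM2l => //.
  rewrite -expectZ -expectB; apply: le_expect => // s sn.
  rewrite (Msplit s).
  have := ler_wpM2l (expR_ge0 (- mu * M (del i s))) (expR_ge1Dx (- (mu * D i s))).
  by lra.
apply: (le_trans (ler_sum _ (fun i _ => step i))).
rewrite -mulr_sumr -mulrA; apply: ler_wpM2l => //.
rewrite big_split /= sumr_const card_ord -mulr_sumr.
rewrite -[_ *+ n]mulr_natl [(_ + _) * F]mulrDl -[n%:R * s2 * F]mulrA lerD2l.
(* Negative association: [M] is increasing and [expR (- mu * M)] decreasing
   in the value of [M]. *)
have assoc : expect q n (fun s => expR (- mu * M s) * M s) <= expect q n M * F.
  rewrite /F -subr_ge0 -expectZ -expectB.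
  set E := expect q n M.
  apply: (@le_trans _ _ (expect q n (fun s => expR (- mu * E) * (E - M s)))).
    by rewrite expectZ expectB expect_cst// subrr mulr0.
  apply: le_expect => // s _.
  have -> : E * expR (- mu * M s) - expR (- mu * M s) * M s =
    expR (- mu * M s) * (E - M s) by ring.
  have [ME|EM] := leP (M s) E.
    by apply: ler_wpM2r; [rewrite subr_ge0|rewrite ler_expR !mulNr lerN2 ler_wpM2l].
  apply: ler_wnM2r; first by rewrite subr_le0 ltW.
  by rewrite ler_expR !mulNr lerN2 ler_wpM2l// ltW.
have EM0 := expect_maxk_ge0 n.
have F0 : 0 <= F by apply: expect_ge0 => // s _; exact: expR_ge0.
apply: (@le_trans _ _ ((1 + tau) * (expect q n M * F))).
  apply: ler_wpM2l; first by case/andP: tau0 => *; lra.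
  apply: le_trans assoc.
  rewrite -expect_sum; apply: le_expect => // s sn.
  rewrite -mulr_sumr; apply: ler_wpM2l; first exact: expR_ge0.
  by have := sum_incr_le u k0 b0 s; rewrite sn.
rewrite -mulrA; apply: ler_wpM2r; first exact: mulr_ge0.
by case/andP: tau0 => *; lra.
Qed.

(** The term [2 * E (expR (mu * M) * M)] of [entropy_upper] is twice the
    derivative of the exponential moment, so Herbst's argument applies with
    [kappa = 1]. *)
Lemma mgf_upper n (mu : R) : 0 < mu < 1 -> (forall k b, `|u k b| <= 1) ->
  expect q n (fun s => expR (mu * M s)) <=
  expR (mu * expect q n M +
        mu ^+ 2 * (n%:R * s2 + 2 * expect q n M) / (2 * (1 - mu))).
Proof.
move=> /andP[mu0 mu1] u1.
have s20 : 0 <= s2.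
  by apply: le_trans (u_var k0); apply: sumr_ge0 => b _; rewrite mulr_ge0 ?sqr_ge0.
have F0 : 0 < expect q n (fun s => expR (mu * M s)).
  by apply: expect_gt0 => // s; exact: expR_gt0.
have := @herbst _ _ q q_ge0 q_sum1 n M (1 * n%:R) 1 mu
  (fun x => n%:R * s2 / 2 * x) (fun=> n%:R * s2 / 2).
move=> /(_ _ _ (ltW mu1) _ _ _ mu) H.
rewrite -[leLHS](@lnK R) ?posrE// ler_expR.
have {H} : ln (expect q n (fun s => expR (mu * M s))) * (mu^-1 - 1) <=
    expect q n M + n%:R * s2 / 2 * mu.
  apply: H => //; last by rewrite mu0/=.
  - by move=> s sn; rewrite -sn; exact: norm_maxk_le.
  - by rewrite ler01 lexx.
  - move=> x _.
    rewrite (_ : (fun y => _) = (n%:R * s2 / 2) *: id) //.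
    by apply: is_derive_eq; rewrite /GRing.scale /= mulr1.
  - by move=> x /andP[x0 _]; rewrite mulr_ge0 ?(ltW x0)// divr_ge0// mulr_ge0.
  - move=> x /andP[x0 x1].
    have ub k b : u k b <= 1 by have := u1 k b; rewrite ler_norml => /andP[].
    have := entropy_upper n (ltW x0) ub.
    under eq_expect => s _ do rewrite mulrCA.
    rewrite expectZ => H1; rewrite -subr_ge0; move: H1; rewrite -subr_ge0.
    by congr (_ <= _); field.
rewrite (_ : mu^-1 - 1 = (1 - mu) / mu); last by field; rewrite gt_eqF.
have m1 : 0 < 1 - mu by lra.
rewrite mulrA ler_pdivrMr// -ler_pdivlMr// => /le_trans; apply.
by rewrite le_eqVlt; apply/orP; left; apply/eqP; field; rewrite gt_eqF.
Qed.

Lemma mgf_lower n (mu : R) : 0 < mu <= 2 / 5 ->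
  (forall k b, `|u k b| <= 1 / 2) -> s2 <= 1 / 4 ->
  expect q n (fun s => expR (- mu * M s)) <=
  expR (- mu * expect q n M +
        mu ^+ 2 * (n%:R * s2 + 4 * expect q n M) / (2 * (1 - mu))).
Proof.
move=> /andP[mu0 mu1] u1 s21.
have s20 : 0 <= s2.
  by apply: le_trans (u_var k0); apply: sumr_ge0 => b _; rewrite mulr_ge0 ?sqr_ge0.
have V0 : 0 <= n%:R * s2 + 4 * expect q n M.
  by rewrite addr_ge0// mulr_ge0// expect_maxk_ge0.
set V := n%:R * s2 + 4 * expect q n M in V0 *.
have F0 : 0 < expect q n (fun s => expR (- mu * M s)).
  by apply: expect_gt0 => // s; exact: expR_gt0.
have mu1' : mu <= 1 by lra.
have Erw x : expect q n (fun s => expR (x * - M s)) =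
             expect q n (fun s => expR (- x * M s)).
  by apply: eq_expect => s _; rewrite mulrN mulNr.
have NC s : size s = n -> `|- M s| <= 1 / 2 * n%:R.
  by move=> sn; rewrite -sn normrN; exact: norm_maxk_le.
pose rho (x : R) := V / 2 * ((1 - x)^-1 - 1).
pose drho (x : R) := V / 2 * (1 - x) ^- 2.
have rhod (x : R) : 0 < x <= mu -> is_derive x 1 rho (drho x).
  move=> /andP[x0 x1].
  have d1 : is_derive x 1 (fun y : R => 1 - y) (-1).
    rewrite (_ : (fun y => _) = cst 1 - id) //.
    by apply: is_derive_eq; rewrite sub0r.
  have x1n : 1 - x != 0 by rewrite subr_eq0 gt_eqF//; lra.
  have d2 := @is_deriveV R (fun y : R => 1 - y) x _ _ x1n d1.
  rewrite (_ : rho = (V / 2) *: ((fun y : R => (1 - y)^-1) - cst 1)) //.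
  by apply: is_derive_eq; rewrite /drho /GRing.scale /=; ring.
have rho0 (x : R) : 0 < x <= mu -> 0 <= rho x.
  move=> /andP[x0 x1]; rewrite /rho mulr_ge0 ?divr_ge0// subr_ge0.
  by rewrite invf_ge1; lra.
have ent (x : R) : 0 < x <= mu ->
    (x - 0 * x ^+ 2) * expect q n (fun s => expR (x * - M s) * - M s)
     - expect q n (fun s => expR (x * - M s)) *
       ln (expect q n (fun s => expR (x * - M s)))
     <= x ^+ 2 * drho x * expect q n (fun s => expR (x * - M s)).
  move=> /andP[x0 x1].
  have x01 : 0 <= x <= 2 / 5 by rewrite (ltW x0) (le_trans x1).
  have := entropy_lower n x01 u1 s21; rewrite (Erw x) -/V.
  have -> : expect q n (fun s => expR (- x * M s) * (- x * M s)) =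
    x * expect q n (fun s => expR (x * - M s) * - M s).
    rewrite -expectZ; apply: eq_expect => s _.
    by rewrite !mulNr mulrN mulrCA !mulrN.
  move=> H1; rewrite -subr_ge0; move: H1; rewrite -subr_ge0 /drho.
  by congr (_ <= _); field; lra.
rewrite -[leLHS](@lnK R) ?posrE// ler_expR.
have mumu : 0 < mu <= mu by rewrite mu0/=.
have k01 : 0 <= (0 : R) <= 1 by rewrite lexx ler01.
have := herbst q_ge0 q_sum1 NC k01 mu1' rhod rho0 ent mumu.
rewrite (Erw mu) expectN /rho.
rewrite subr0 ler_pdivrMr// => /le_trans; apply.
rewrite le_eqVlt; apply/orP; left; apply/eqP; field.
by rewrite gt_eqF//; lra.
Qed.

End Concentration.

(** * Symmetrization *)

Section ConvexMaximum.
Context {R : realType} {K : finType}.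
Variable k0 : K.

Definition omax (c : K -> R) : R := c [arg max_(k > k0) c k]%O.

Lemma omax_ge c k : c k <= omax c.
Proof. by rewrite /omax; case: arg_maxP => // j _ /(_ k); apply. Qed.

Definition finitely_convex (phi : (K -> R) -> R) :=
  forall (I : finType) (w : I -> R) (c : I -> K -> R),
    (forall i, 0 <= w i) -> \sum_i w i = 1 ->
    phi (fun k => \sum_i w i * c i k) <= \sum_i w i * phi (c i).

Lemma omax_convex : finitely_convex omax.
Proof.
move=> I w c w0 _; rewrite {1}/omax; case: arg_maxP => // k _ _.
by apply: ler_sum => i _; apply: ler_wpM2l => //; exact: omax_ge.
Qed.

End ConvexMaximum.

Section Symmetrization.
Context {R : realType} {A K : finType}.
Variables (p : A -> R) (v : K -> A -> R) (k0 : K).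
Hypothesis p_ge0 : forall a, 0 <= p a.
Hypothesis p_sum1 : \sum_a p a = 1.

Definition signed_law (b : A * bool) : R := p b.1 / 2.
Definition centered (k : K) (a : A) : R := v k a - \sum_a' p a' * v k a'.
Definition rademacher_signed (k : K) (b : A * bool) : R := (-1) ^+ b.2 * v k b.1.

Lemma signed_law_ge0 b : 0 <= signed_law b.
Proof. by rewrite divr_ge0. Qed.

Lemma sum_signed_law (h : A * bool -> R) :
  \sum_b signed_law b * h b =
  \sum_a p a * (h (a, false) + h (a, true)) / 2.
Proof.
transitivity (\sum_a \sum_e signed_law (a, e) * h (a, e)).
  by rewrite pair_bigA; apply: eq_bigr => -[].
by apply: eq_bigr => a _; rewrite big_bool /signed_law /=; field.
Qed.

Lemma signed_law_sum1 : \sum_b signed_law b = 1.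
Proof.
rewrite -p_sum1; have := sum_signed_law (fun=> 1).
under eq_bigr do rewrite mulr1.
by move=> ->; apply: eq_bigr => a _; field.
Qed.

(** The value of a centred function at [a] is the mean of [v k a - v k a'] over
    an independent copy [a'], and [v k a - v k a'] is the midpoint of [2 * v k a]
    and [- (2 * v k a')].  A single use of convexity gives both steps. *)
Lemma symmetrize_letter (phi : (K -> R) -> R) : finitely_convex phi ->
  \sum_a p a * phi (centered ^~ a) <=
  \sum_b signed_law b * phi (fun k => 2 * rademacher_signed k b).
Proof.
move=> cvx.
have step a : phi (centered ^~ a) <=
    (phi (fun k => 2 * v k a) + \sum_a' p a' * phi (fun k => - (2 * v k a'))) / 2.
  pose c (b : A * bool) k : R := if b.2 then - (2 * v k b.1) else 2 * v k a.
  have -> : centered ^~ a = fun k => \sum_b signed_law b * c b k.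
    apply/funext => k; rewrite (sum_signed_law (c ^~ k)) /c /=.
    have E : v k a = \sum_a' p a' * v k a by rewrite -mulr_suml p_sum1 mul1r.
    rewrite [LHS]/(v k a - _) [X in X - _ = _]E -sumrB.
    by apply: eq_bigr => a' _; field.
  apply: (le_trans (cvx _ _ _ signed_law_ge0 signed_law_sum1)).
  rewrite (sum_signed_law (fun b => phi (c b))) /=.
  rewrite le_eqVlt; apply/orP; left; apply/eqP.
  have E x : x = \sum_a' p a' * x by rewrite -mulr_suml p_sum1 mul1r.
  rewrite [X in (X + _) / 2]E -big_split /= mulr_suml.
  by apply: eq_bigr => a' _; rewrite mulrDr.
apply: (le_trans (ler_sum _ (fun a _ => ler_wpM2l (p_ge0 a) (step a)))).
rewrite (sum_signed_law (fun b => phi (fun k => 2 * rademacher_signed k b))).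
under eq_bigr => a _ do rewrite mulrA mulrDr.
under [X in _ <= X]eq_bigr => a _ do rewrite mulrDr.
rewrite -!mulr_suml !big_split /= -mulr_suml p_sum1 mul1r.
rewrite le_eqVlt; apply/orP; left; apply/eqP; congr ((_ + _) / _);
  apply: eq_bigr => a _; congr (_ * phi _); apply/funext => k.
  by rewrite /rademacher_signed /= expr0 mul1r.
by rewrite /rademacher_signed /= expr1 mulN1r mulrN.
Qed.

Lemma sumk_cons (B : finType) (u : K -> B -> R) k b s :
  sumk u k (b :: s) = u k b + sumk u k s.
Proof. by rewrite /sumk big_cons. Qed.

(** The offset [c] carries the part of the sum that has already been treated,
    which lets the letters be symmetrized one at a time; the expectation over
    the remaining letters is a convex function of the offset. *)
Lemma symmetrization_offset n (c : K -> R) :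
  expect p n (fun s => omax k0 (fun k => c k + sumk centered k s)) <=
  expect signed_law n
    (fun s => omax k0 (fun k => c k + 2 * sumk rademacher_signed k s)).
Proof.
elim: n c => [|n IH] c /=.
  rewrite le_eqVlt; apply/orP; left; apply/eqP; congr omax; apply/funext => k.
  by rewrite /sumk !big_nil mulr0.
pose Phi c := expect signed_law n
  (fun s => omax k0 (fun k => c k + 2 * sumk rademacher_signed k s)).
apply: (@le_trans _ _ (\sum_a p a * Phi (fun k => c k + centered k a))).
  apply: ler_sum => a _; apply: ler_wpM2l => //.
  apply: le_trans (IH _); rewrite le_eqVlt; apply/orP; left; apply/eqP.
  apply: eq_expect => s _; congr omax; apply/funext => k.
  by rewrite sumk_cons addrA.
have cvx : finitely_convex (fun d => Phi (fun k => c k + d k)).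
  move=> I w d w0 w1; rewrite /Phi.
  under [X in _ <= X]eq_bigr => i _ do rewrite -expectZ.
  rewrite -expect_sum; apply: le_expect; first exact: signed_law_ge0.
  move=> s _.
  apply: le_trans (omax_convex k0 _ w0 w1).
  rewrite le_eqVlt; apply/orP; left; apply/eqP; congr omax; apply/funext => k.
  under [RHS]eq_bigr => i _ do rewrite addrAC mulrDr.
  by rewrite big_split /= -mulr_suml w1 mul1r addrAC.
apply: (le_trans (symmetrize_letter cvx)).
rewrite le_eqVlt; apply/orP; left; apply/eqP; apply: eq_bigr => b _.
congr (_ * _); rewrite /Phi; apply: eq_expect => s _; congr omax; apply/funext => k.
by rewrite sumk_cons mulrDr addrA.
Qed.

Lemma symmetrization n :
  expect p n (maxk centered k0) <=
  2 * expect signed_law n (maxk rademacher_signed k0).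
Proof.
rewrite -expectZ.
have -> : expect p n (maxk centered k0) =
    expect p n (fun s => omax k0 (fun k => 0 + sumk centered k s)).
  apply: eq_expect => s _; rewrite -[LHS]/(omax k0 (sumk centered ^~ s)).
  by congr omax; apply/funext => k; rewrite add0r.
apply: le_trans (symmetrization_offset n (fun=> 0)) _.
apply: le_expect; first exact: signed_law_ge0.
move=> s _; rewrite /omax add0r; apply: ler_wpM2l => //; exact: maxk_ge.
Qed.

Lemma expect_marginal n (h : seq A -> R) :
  expect signed_law n (fun s => h (unzip1 s)) = expect p n h.
Proof.
elim: n h => [//|n IH] h /=.
rewrite (sum_signed_law (fun b => expect signed_law n
  (fun s => h (b.1 :: unzip1 s)))) /=.
apply: eq_bigr => a _; rewrite (IH (fun s => h (a :: s))); lra.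
Qed.

Definition fair_coin (e : bool) : R := 1 / 2.

Lemma fair_coin_ge0 e : 0 <= fair_coin e. Proof. by rewrite /fair_coin. Qed.

Lemma fair_coin_sum1 : \sum_e fair_coin e = 1.
Proof. by rewrite big_bool /fair_coin /=; lra. Qed.

Lemma expect_signed n (h : seq (A * bool) -> R) :
  expect signed_law n h =
  expect p n (fun s => expect fair_coin n (fun e => h (zip s e))).
Proof.
elim: n h => [//|n IH] h /=.
rewrite (sum_signed_law (fun b => expect signed_law n (fun s => h (b :: s)))).
apply: eq_bigr => a _; rewrite !IH.
under [X in _ = _ * X]eq_expect => s _ do rewrite big_bool /=.
by rewrite expectD !expectZ /fair_coin; lra.
Qed.

End Symmetrization.

(** Jensen's inequality for the exponential. *)
Lemma expR_expect_le (R : realType) (B : finType) (q : B -> R) n (h : seq B -> R) :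
  (forall b, 0 <= q b) -> \sum_b q b = 1 ->
  expR (expect q n h) <= expect q n (fun s => expR (h s)).
Proof.
move=> q0 q1; set c := expect q n h.
apply: (@le_trans _ _ (expect q n (fun s => expR c * (1 + (h s - c))))).
  by rewrite expectZ expectD expectB !expect_cst// subrr addr0 mulr1.
apply: le_expect => // s _.
rewrite [X in _ <= expR X](_ : h s = c + (h s - c)); last by rewrite addrC subrK.
by rewrite expRD; apply: ler_wpM2l; [exact: expR_ge0|exact: expR_ge1Dx].
Qed.

(** * The tail bounds over a finite alphabet *)

Section SignedMaximum.
Context {R : realType} {B J : finType}.
Variables (w : J -> B -> R) (j0 : J).

Definition signed (k : J * bool) (b : B) : R := (-1) ^+ k.2 * w k.1 b.
Definition normax (s : seq B) : R := maxk signed (j0, false) s.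

Lemma sumk_signed k s : sumk signed k s = (-1) ^+ k.2 * sumk w k.1 s.
Proof. by rewrite /sumk mulr_sumr. Qed.

Lemma normax_ge j s : `|sumk w j s| <= normax s.
Proof.
have H e : (-1) ^+ (e : bool) * sumk w j s <= normax s.
  by have := maxk_ge signed (j0, false) (j, e) s; rewrite sumk_signed.
have := H true; have := H false; rewrite expr0 expr1 mul1r mulN1r => H0 H1.
by rewrite ler_norml H0 andbT lerNl.
Qed.

Lemma normax_ge0 s : 0 <= normax s.
Proof. exact: le_trans (normr_ge0 _) (normax_ge j0 s). Qed.

Lemma normax_attained s : exists j, normax s = `|sumk w j s|.
Proof.
exists (argk signed (j0, false) s).1; apply/eqP; rewrite eq_le normax_ge andbT.
rewrite /normax /maxk sumk_signed; set k := argk _ _ _.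
by apply: le_trans (ler_norm _) _; rewrite normrMsign.
Qed.

End SignedMaximum.

Section FiniteTail.
Context {R : realType} {A J : finType}.
Variables (p : A -> R) (f : J -> A -> R) (j0 : J) (s2 : R).
Hypothesis p_ge0 : forall a, 0 <= p a.
Hypothesis p_sum1 : \sum_a p a = 1.
Hypothesis f_bounded : forall j a, `|f j a| <= 1 / 2.
Hypothesis f_var : forall j, \sum_a p a * f j a ^+ 2 <= s2.
Hypothesis s2_le : s2 <= 1 / 4.

Let Z := normax (centered p f) j0.
Let Y := normax (rademacher_signed f) j0.
Let Q := signed_law p.

Let Q_ge0 : forall b, 0 <= Q b. Proof. exact: signed_law_ge0. Qed.
Let Q_sum1 : \sum_b Q b = 1. Proof. exact: signed_law_sum1. Qed.

Lemma centered_mean j : \sum_a p a * centered p f j a = 0.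
Proof.
under eq_bigr => a _ do rewrite mulrBr.
by rewrite sumrB -mulr_suml p_sum1 mul1r subrr.
Qed.

Lemma centered_var j : \sum_a p a * centered p f j a ^+ 2 <= s2.
Proof.
apply: le_trans (f_var j); set m := \sum_a p a * f j a.
have -> : \sum_a p a * centered p f j a ^+ 2 =
    \sum_a p a * f j a ^+ 2 - m ^+ 2.
  transitivity (\sum_a (p a * f j a ^+ 2 - 2 * m * (p a * f j a) + m ^+ 2 * p a)).
    by apply: eq_bigr => a _; rewrite /centered -/m; ring.
  by rewrite big_split sumrB /= -!mulr_sumr p_sum1 -/m; ring.
by rewrite gerBl sqr_ge0.
Qed.

Lemma centered_le1 j a : `|centered p f j a| <= 1.
Proof.
apply: (le_trans (ler_normB _ _)).
have : `|\sum_a' p a' * f j a'| <= 1 / 2.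
  apply: (le_trans (ler_norm_sum _ _ _)).
  apply: (@le_trans _ _ (\sum_a' p a' * (1 / 2))).
    by apply: ler_sum => a' _; rewrite normrM ger0_norm// ler_wpM2l.
  by rewrite -mulr_suml p_sum1 mul1r.
by have := f_bounded j a; lra.
Qed.

Lemma symmetrization_normax n : expect p n Z <= 2 * expect Q n Y.
Proof.
have := symmetrization (signed f) (j0, false) p_ge0 p_sum1 n.
have -> : centered p (signed f) = signed (centered p f).
  apply/funext => k; apply/funext => a; rewrite /centered /signed mulrBr mulr_sumr.
  by congr (_ - _); apply: eq_bigr => a' _; rewrite mulrCA.
have -> // : rademacher_signed (signed f) = signed (rademacher_signed f).
by apply/funext => k; apply/funext => b; rewrite /rademacher_signed /signed mulrCA.
Qed.

Let V n := n%:R * s2 + 4 * expect Q n Y.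

Let s2_ge0 : 0 <= s2.
Proof.
by apply: le_trans (f_var j0); apply: sumr_ge0 => a _; rewrite mulr_ge0 ?sqr_ge0.
Qed.

Let EY_ge0 n : 0 <= expect Q n Y.
Proof. by apply: expect_ge0 => // s _; exact: normax_ge0. Qed.

Lemma chernoff_exponent (t v : R) : 0 < t -> 0 < v ->
  - (t / (v + t) * t) + (t / (v + t)) ^+ 2 * v / (2 * (1 - t / (v + t))) =
  - (t ^+ 2 / (2 * v + 2 * t)).
Proof. by move=> t0 v0; field; rewrite !gt_eqF//; lra. Qed.

Lemma markov_expect (B : finType) (q : B -> R) n (X : seq B -> R) (mu c : R) :
  (forall b, 0 <= q b) -> 0 <= mu ->
  expect q n (fun s => (c <= X s)%R%:R) <=
  expect q n (fun s => expR (mu * X s)) * expR (- (mu * c)).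
Proof.
move=> q0 mu0; rewrite -expectZr; apply: le_expect => // s _.
rewrite -expRD; case: (leP c (X s)) => [cX|_]; last exact: expR_ge0.
by rewrite -expR0 ler_expR subr_ge0 ler_wpM2l.
Qed.

Lemma upper_tail n t : 0 < t ->
  expect p n (fun s => (2 * expect Q n Y + t <= Z s)%R%:R) <=
  expR (- (t ^+ 2 / (2 * V n + 2 * t))).
Proof.
move=> t0; set EY := expect Q n Y.
have V0 : 0 <= V n by rewrite /V addr_ge0// mulr_ge0.
have EZ : expect p n Z <= 2 * EY by exact: symmetrization_normax.
have mgf mu : 0 < mu < 1 -> expect p n (fun s => (2 * EY + t <= Z s)%R%:R) <=
    expR (- (mu * t) + mu ^+ 2 * V n / (2 * (1 - mu))).
  move=> /[dup] mu01 /andP[mu0 mu1].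
  apply: (le_trans (markov_expect n Z _ p_ge0 (ltW mu0))).
  have := @mgf_upper _ _ _ p (signed (centered p f)) (j0, false) s2 p_ge0 p_sum1
    _ _ n mu mu01 _.
  move=> H; apply: le_trans (ler_wpM2r (expR_ge0 _) (H _ _ _)) _.
  - move=> k; under eq_bigr => a _ do rewrite /signed mulrCA.
    by rewrite -mulr_sumr centered_mean mulr0.
  - move=> k; under eq_bigr => a _ do rewrite /signed exprMn sqrr_sign mul1r.
    exact: centered_var.
  - by move=> k a; rewrite /signed normrMsign centered_le1.
  rewrite -/Z -expRD ler_expR.
  have mu1' : 0 < 2 * (1 - mu) by lra.
  have : mu ^+ 2 * (n%:R * s2 + 2 * expect p n Z) / (2 * (1 - mu)) <=
         mu ^+ 2 * V n / (2 * (1 - mu)).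
    rewrite ler_pM2r ?invr_gt0//; apply: ler_wpM2l; first exact: sqr_ge0.
    by rewrite /V -/EY lerD2l; lra.
  have : mu * expect p n Z <= mu * (2 * EY) by rewrite ler_wpM2l// ltW.
  by lra.
have [V1|V1] := ltP 0 (V n).
  rewrite -chernoff_exponent//; apply: mgf.
  have Vt : 0 < V n + t by rewrite addr_gt0.
  by rewrite (divr_gt0 t0 Vt) /= ltr_pdivrMr// mul1r ltrDr.
have VE : V n = 0 by apply/eqP; rewrite eq_le V1.
(* For [V n = 0] the optimal parameter would be the excluded value [1]. *)
have := mgf (1 / 2); rewrite VE !mulr0 mul0r addr0 add0r.
have -> : t ^+ 2 / (2 * t) = 1 / 2 * t by field; rewrite gt_eqF.
by apply; apply/andP; split; lra.
Qed.

(** As [n * s2 + 4 * E Y] exceeds [4 * t], the optimal parameter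
    [t / (V n + t)] is in the range of [mgf_lower]. *)
Lemma lower_tail n t (T : seq (A * bool) -> R) :
  0 < t < expect Q n Y ->
  (forall mu, 0 <= mu -> expect Q n (fun s => expR (- mu * T s)) <=
                         expect Q n (fun s => expR (- mu * Y s))) ->
  expect Q n (fun s => (T s <= expect Q n Y - t)%R%:R) <=
  expR (- (t ^+ 2 / (2 * V n + 2 * t))).
Proof.
move=> /andP[t0 tE] TY; set EY := expect Q n Y.
have V4 : 4 * t < V n.
  have := mulr_ge0 (ler0n R n) s2_ge0; rewrite /V -/EY => ?.
  by have : t < EY by []; lra.
have V0 : 0 < V n by lra.
pose mu := t / (V n + t).
have mu0 : 0 < mu by rewrite divr_gt0// addr_gt0.
have mu1 : mu <= 2 / 5.
  rewrite /mu ler_pdivrMr; last exact: addr_gt0.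
  by move: V4; set v := V n => V4; lra.
have H : expect Q n (fun s => (T s <= EY - t)%R%:R) <=
    expect Q n (fun s => expR (mu * - T s)) * expR (- (mu * - (EY - t))).
  apply: le_trans (markov_expect n (fun s => - T s) _ Q_ge0 (ltW mu0)).
  by apply: le_expect => // s _; rewrite lerN2.
apply: (le_trans H).
under eq_expect => s _ do rewrite mulrN -mulNr.
apply: le_trans (ler_wpM2r (expR_ge0 _) (TY _ (ltW mu0))) _.
have := @mgf_lower _ _ _ Q (signed (rademacher_signed f)) (j0, false) s2 Q_ge0
   Q_sum1 _ _ n mu _ _ s2_le.
rewrite mu0 mu1 => K; apply: le_trans (ler_wpM2r (expR_ge0 _) (K _ _ _ _)) _ => //.
- move=> k; rewrite sum_signed_law /signed /rademacher_signed /= big1// => a _.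
  by rewrite expr0 expr1; ring.
- move=> k; rewrite sum_signed_law /signed /rademacher_signed /=.
  under eq_bigr => a _ do rewrite !exprMn !sqrr_sign !mul1r.
  apply: le_trans (f_var k.1); apply: ler_sum => a _.
  by rewrite le_eqVlt; apply/orP; left; apply/eqP; field.
- by move=> k b; rewrite /signed /rademacher_signed !normrMsign.
rewrite -/Y -/EY -/(V n) -expRD ler_expR -chernoff_exponent// -/mu.
by rewrite le_eqVlt; apply/orP; left; apply/eqP; ring.
Qed.

(** On the event, [T s > E Y - t] gives [2 * E Y + t <= Z] by addition.  When
    [E Y <= t] this conclusion holds on the whole event, because [T s >= 0], so
    the lower tail is not called for outside the range of [lower_tail]. *)
Lemma finite_tail n t (T : seq (A * bool) -> R) : 0 < t ->
  (forall s, 0 <= T s) ->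
  (forall mu, 0 <= mu -> expect Q n (fun s => expR (- mu * T s)) <=
                         expect Q n (fun s => expR (- mu * Y s))) ->
  expect Q n (fun s => (2 * T s + 3 * t <= Z (unzip1 s))%R%:R) <=
  2 * expR (- (t ^+ 2 / (2 * V n + 2 * t))).
Proof.
move=> t0 T0 TY; set EY := expect Q n Y; set e := expR _.
have := upper_tail n t0; rewrite -(expect_marginal p) -/Q -/EY -/e => up.
have -> : 2 * e = e + e by ring.
have [tE|Et] := ltP t EY.
  have t0E : 0 < t < expect Q n Y by rewrite t0.
  apply: le_trans (lerD up (lower_tail t0E TY)).
  rewrite -expectD -/EY; apply: le_expect => // s _.
  case: (leP (2 * T s + 3 * t)) => [H|_]; last by rewrite addr_ge0.
  case: (leP (2 * EY + t)) => [_|H1]; first by rewrite lerDl.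
  have -> : T s <= EY - t by lra.
  by rewrite add0r.
apply: (@le_trans _ _ e); last by rewrite lerDl expR_ge0.
apply: le_trans up; apply: le_expect => // s _.
case: (leP (2 * T s + 3 * t)) => [H|_] //; have Ts := T0 s.
by have -> : 2 * EY + t <= Z (unzip1 s) by lra.
Qed.

Definition sign_mean n (s : seq A) : R := expect fair_coin n (fun e => Y (zip s e)).

Lemma finite_tail_signs n t : 0 < t ->
  expect Q n (fun s => (2 * Y s + 3 * t <= Z (unzip1 s))%R%:R) <=
  2 * expR (- (t ^+ 2 / (2 * V n + 2 * t))).
Proof. by move=> t0; apply: finite_tail => // s; exact: normax_ge0. Qed.

Lemma finite_tail_mean n t : 0 < t ->
  expect Q n (fun s => (2 * sign_mean n (unzip1 s) + 3 * t <= Z (unzip1 s))%R%:R) <=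
  2 * expR (- (t ^+ 2 / (2 * V n + 2 * t))).
Proof.
move=> t0; apply: finite_tail => // [s|mu mu0].
  apply: expect_ge0 => [e||e _]; [exact: fair_coin_ge0|exact: fair_coin_sum1|].
  exact: normax_ge0.
rewrite (expect_marginal p n (fun s => expR (- mu * sign_mean n s))).
rewrite expect_signed; apply: le_expect => // s _.
rewrite /sign_mean -expectZ; apply: expR_expect_le.
  exact: fair_coin_ge0.
exact: fair_coin_sum1.
Qed.

End FiniteTail.

(** * Laws of finitely valued random variables *)

Lemma expect_tuple (R : realType) (B : finType) (q : B -> R) n (h : seq B -> R) :
  expect q n h = \sum_(s : n.-tuple B) (\prod_(b <- s) q b) * h s.
Proof.
elim: n h => [|n IH] h /=.
  rewrite (big_pred1 [tuple]) ?big_nil ?mul1r// => s.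
  by rewrite (tuple0 s) /= eq_refl.
under eq_bigr => b _ do rewrite IH mulr_sumr.
rewrite pair_bigA /= (reindex (fun bs : B * n.-tuple B => [tuple of bs.1 :: bs.2])).
  by apply: eq_bigr => -[b s] _; rewrite big_cons /= mulrA.
exists (fun s => (thead s, [tuple of behead s])) => [[b s] _|s _].
  by congr pair; apply: val_inj.
by rewrite -tuple_eta.
Qed.

Section FiniteLaw.
Context (d : measure_display) (T : measurableType d) (R : realType).
Variable mu : probability T R.

Lemma bounded_integrable (h : T -> R) (c : R) :
  measurable_fun [set: T] h -> (forall x, `|h x| <= c) ->
  mu.-integrable [set: T] (EFin \o h).
Proof.
move=> mh hc; apply: measurable_bounded_integrable => //.
  by rewrite [X in (X < _)%E](probability_setT mu) ltry.
exists c; split; first exact: num_real.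
by move=> e ce x _; exact: le_trans (hc x) (ltW ce).
Qed.

Lemma Rintegral_shift_le (g h : T -> R) (c b b' : R) :
  measurable_fun [set: T] g -> measurable_fun [set: T] h ->
  (forall x, `|g x| <= b) -> (forall x, `|h x| <= b') ->
  (forall x, g x <= h x + c) ->
  Rintegral mu [set: T] g <= Rintegral mu [set: T] h + c.
Proof.
move=> mg mh gb hb gh.
have ic : mu.-integrable [set: T] (EFin \o (fun=> c)).
  by apply: (bounded_integrable (c := `|c|)) => //; exact: measurable_cst.
have ig := bounded_integrable mg gb; have ih := bounded_integrable mh hb.
have -> : c = Rintegral mu [set: T] (fun=> c).
  rewrite Rintegral_cst// [X in fine X](_ : _ = 1%E) ?mulr1//.
  exact: probability_setT.
rewrite -RintegralD//; apply: le_Rintegral => //.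
by have := integrableD measurableT ih ic.
Qed.

Variables (C : finType) (tau : T -> C) (lam : C -> R).
Hypothesis tau_meas : forall c, measurable (tau @^-1` [set c]).
Hypothesis tau_law : forall c, mu (tau @^-1` [set c]) = (lam c)%:E.

Lemma finite_valued_expansion (phi : C -> R) x :
  phi (tau x) = \sum_c phi c * \1_(tau @^-1` [set c]) x.
Proof.
rewrite (bigD1 (tau x)) //= big1 ?addr0 => [|c cx].
  by rewrite indicE mem_set// mulr1.
by rewrite indicE memNset ?mulr0// => /esym/eqP; rewrite (negPf cx).
Qed.

Lemma measurable_finite_valued (phi : C -> R) :
  measurable_fun [set: T] (fun x => phi (tau x)).
Proof.
under eq_fun => x do rewrite finite_valued_expansion.
apply: measurable_sum => c; apply: measurable_funM; first exact: measurable_cst.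
exact: measurable_indic.
Qed.

Lemma finite_valued_bounded (phi : C -> R) x :
  `|phi (tau x)| <= \sum_c `|phi c|.
Proof. by rewrite (bigD1 (tau x)) //= lerDl sumr_ge0. Qed.

Lemma Rintegral_finite_law (phi : C -> R) :
  Rintegral mu [set: T] (fun x => phi (tau x)) = \sum_c lam c * phi c.
Proof.
rewrite /Rintegral.
under eq_integral => x _ do rewrite finite_valued_expansion -sumEFin.
rewrite integral_sum//.
  under eq_bigr => c _.
    under eq_integral => x _ do rewrite EFinM.
    rewrite integralZl//; last first.
      by apply: integrable_indic => //; rewrite [X in (X < _)%E](tau_law c) ltry.
    rewrite integral_indic// setIT [X in (_ * X)%E](tau_law c) -EFinM.
    over.
  by rewrite sumEFin /=; apply: eq_bigr => c _; rewrite mulrC.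
move=> c; apply: (bounded_integrable (c := `|phi c|)).
  by apply: measurable_funM; [exact: measurable_cst|exact: measurable_indic].
by move=> x; rewrite normrM ler_piMr// indicE; case: (_ \in _); rewrite ?normr1 ?normr0.
Qed.

Lemma measurable_finite_event (b : pred C) : measurable [set x | b (tau x)].
Proof.
have -> : [set x | b (tau x)] =
    \big[setU/set0]_(c <- enum b) (tau @^-1` [set c]).
  apply/seteqP; split => x /=.
    by move=> bx; rewrite -bigcup_seq; exists (tau x) => //=; rewrite mem_enum.
  by rewrite -bigcup_seq => -[c /=]; rewrite mem_enum => bc ->.
exact: bigsetU_measurable.
Qed.

Lemma prob_finite_law (b : pred C) :
  mu [set x | b (tau x)] = (\sum_c lam c * (b c)%R%:R)%:E.
Proof.
rewrite -(Rintegral_finite_law (fun c => (b c)%:R)) /Rintegral.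
have mE := measurable_finite_event b.
rewrite -[LHS]fineK ?fin_num_measure//; congr (fine _)%:E.
transitivity (\int[mu]_x (\1_[set x | b (tau x)] x)%:E)%E.
  by rewrite integral_indic// setIT.
apply: eq_integral => x _; rewrite indicE; congr ((nat_of_bool _)%:R)%:E.
by apply/idP/idP => [/set_mem|/mem_set].
Qed.

End FiniteLaw.

Section Letters.
Context (R : realType) (dS dX de : measure_display)
  (S : measurableType dS) (P : probability S R)
  (OX : measurableType dX) (PX : probability OX R)
  (Oe : measurableType de) (Pe : probability Oe R).
Variables (Xs : nat -> {RV PX >-> S}) (eps : nat -> {RV Pe >-> R}).
Hypothesis Xs_law : forall i, has_law (Xs i) P.
Hypothesis Xs_indep : mutually_independent Xs.
Hypothesis eps_law : forall i, rademacher (eps i).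
Hypothesis eps_indep : mutually_independent eps.

Lemma independent_ord (d d' : measure_display) (T : measurableType d)
    (T' : measurableType d') (mu : probability T R) (Y : nat -> {RV mu >-> T'})
    n (B : 'I_n -> set T') :
  mutually_independent Y -> (forall i, measurable (B i)) ->
  mu [set w | forall i : 'I_n, B i (Y i w)] = (\prod_(i < n) mu (Y i @^-1` B i))%E.
Proof.
move=> indep mB.
pose B' k := if insub k is Some i then B i else setT.
have B'E (i : 'I_n) : B' i = B i by rewrite /B' valK.
have mB' k : measurable (B' k) by rewrite /B'; case: insubP.
have := indep (iota 0 n) B' (iota_uniq _ _) mB'.
rewrite -[in X in _ = X -> _](subn0 n) -/(index_iota 0 n) big_mkord.
under eq_bigr => i _ do rewrite B'E.
move=> <-; congr (mu _); apply/seteqP; split => w /=.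
  move=> wB k /=; rewrite mem_iota add0n => /andP[_ kn].
  by have := wB (Ordinal kn); rewrite -B'E.
by move=> wB i; have := wB i; rewrite /= B'E; apply; rewrite mem_iota /=.
Qed.

Variables (A : finType) (pi : S -> A) (n : nat).
Hypothesis pi_meas : forall a, measurable (pi @^-1` [set a]).

Definition letter_law (a : A) : R := fine (P (pi @^-1` [set a])).

Definition signs (w : Oe) : n.-tuple bool := [tuple eps i w == -1 | i < n].
Definition values (w : OX) : n.-tuple A := [tuple pi (Xs i w) | i < n].
(** The sign [-1] is encoded by [true], to agree with [(-1) ^+ true = -1]. *)
Definition letters (w : OX * Oe) : n.-tuple (A * bool) :=
  [tuple (pi (Xs i w.1), eps i w.2 == -1) | i < n].

Lemma letter_law_ge0 a : 0 <= letter_law a.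
Proof. exact: fine_ge0. Qed.

Lemma letter_law_P a : P (pi @^-1` [set a]) = (letter_law a)%:E.
Proof. by rewrite fineK// fin_num_measure. Qed.

Lemma letter_law_sum1 : \sum_a letter_law a = 1.
Proof.
apply: EFin_inj; rewrite -[RHS](probability_setT P).
have := prob_finite_law pi_meas letter_law_P xpredT.
under [in X in _ = X -> _]eq_bigr => a _ do rewrite mulr1.
by move=> <-; congr (P _); apply/seteqP.
Qed.

Let sign_set (b : bool) : set R := [set y | (y == -1) = b].

Lemma sign_set_meas b : measurable (sign_set b).
Proof.
case: b.
  rewrite (_ : sign_set true = [set -1]); first exact: measurable_set1.
  by apply/seteqP; split => y /= /eqP.
rewrite (_ : sign_set false = ~` [set -1]).
  apply: measurableC; exact: measurable_set1.
by apply/seteqP; split => y; rewrite /sign_set /=; case: (y =P -1).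
Qed.

(** Only the probability of the value [-1] matters: all other values, among
    them the null set outside [{-1, 1}], are encoded by [false]. *)
Lemma sign_prob i b : Pe (eps i @^-1` sign_set b) = (@fair_coin R b)%:E.
Proof.
have [_ em] := eps_law i; rewrite /fair_coin div1r.
have mt : Pe (eps i @^-1` sign_set true) = (2^-1)%:E.
  by rewrite -em; congr (Pe (_ @^-1` _)); apply/seteqP; split => y /= /eqP.
case: b => //.
have -> : eps i @^-1` sign_set false = ~` (eps i @^-1` sign_set true).
  by apply/seteqP; split => y; rewrite /sign_set /=; case: (_ =P -1).
rewrite probability_setC ?mt; first by rewrite -EFinB; congr EFin; lra.
exact: measurable_funPTI (sign_set_meas true).
Qed.

Lemma signs_fiber (s : n.-tuple bool) :
  signs @^-1` [set s] = [set w | forall i : 'I_n, sign_set (tnth s i) (eps i w)].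
Proof.
apply/seteqP; split => w /=.
  by move=> <- i; rewrite /sign_set /= tnth_mktuple.
by move=> ws; apply: eq_from_tnth => i; rewrite tnth_mktuple ws.
Qed.

Lemma measurable_forall_ord (d : measure_display) (T : measurableType d)
  (B : 'I_n -> set T) : (forall i, measurable (B i)) ->
  measurable [set w | forall i : 'I_n, B i w].
Proof.
move=> mB; rewrite (_ : mkset _ = \big[setI/setT]_(i < n) B i).
  exact: bigsetI_measurable.
apply/seteqP; split => w /=.
  by move=> wB; elim/big_ind: _ => [//|? ? ? ?|i _]; [split|exact: wB].
move=> wB i; move: wB; rewrite (bigD1 i)//=; by case.
Qed.

Lemma signs_meas s : measurable (signs @^-1` [set s]).
Proof.
rewrite signs_fiber; apply: measurable_forall_ord => i.
exact: measurable_funPTI (sign_set_meas _).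
Qed.

Lemma signs_law s :
  Pe (signs @^-1` [set s]) = (\prod_(b <- s) @fair_coin R b)%:E.
Proof.
rewrite signs_fiber (independent_ord eps_indep (fun i => sign_set_meas (tnth s i))).
transitivity (\prod_(i < n) (@fair_coin R (tnth s i))%:E)%E.
  by apply: eq_bigr => i _; exact: sign_prob.
by rewrite prodEFin big_tuple.
Qed.

Lemma values_fiber (s : n.-tuple A) :
  values @^-1` [set s] =
  [set w | forall i : 'I_n, (pi @^-1` [set tnth s i]) (Xs i w)].
Proof.
apply/seteqP; split => w /=.
  by move=> <- i; rewrite tnth_mktuple.
by move=> ws; apply: eq_from_tnth => i; rewrite tnth_mktuple ws.
Qed.

Lemma values_meas s : measurable (values @^-1` [set s]).
Proof.
rewrite values_fiber; apply: measurable_forall_ord => i.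
exact: measurable_funPTI (pi_meas _).
Qed.

Lemma values_law s :
  PX (values @^-1` [set s]) = (\prod_(a <- s) letter_law a)%:E.
Proof.
rewrite values_fiber (independent_ord Xs_indep (fun i => pi_meas (tnth s i))).
transitivity (\prod_(i < n) (letter_law (tnth s i))%:E)%E.
  by apply: eq_bigr => i _; rewrite -letter_law_P; exact: Xs_law.
by rewrite prodEFin big_tuple.
Qed.

Lemma letters_fiber (s : n.-tuple (A * bool)) :
  letters @^-1` [set s] =
  (values @^-1` [set [tuple of unzip1 s]]) `*` (signs @^-1` [set [tuple of unzip2 s]]).
Proof.
apply/seteqP; split => w /=.
  move=> <-; split; apply: eq_from_tnth => i.
    by rewrite [RHS]tnth_map /values /letters !tnth_mktuple.
  by rewrite [RHS]tnth_map /signs /letters !tnth_mktuple.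
move=> [ws1 ws2]; apply: eq_from_tnth => i; rewrite tnth_mktuple.
have e1 : tnth (values w.1) i = (tnth s i).1 by rewrite ws1 tnth_map.
have e2 : tnth (signs w.2) i = (tnth s i).2 by rewrite ws2 tnth_map.
rewrite [RHS]surjective_pairing -e1 -e2.
by rewrite /values /signs !tnth_mktuple.
Qed.

Lemma letters_meas s : measurable (letters @^-1` [set s]).
Proof.
by rewrite letters_fiber; apply: measurableX; [exact: values_meas|exact: signs_meas].
Qed.

Lemma letters_law s : (PX \x Pe)%E (letters @^-1` [set s]) =
  (\prod_(b <- s) signed_law letter_law b)%:E.
Proof.
rewrite letters_fiber.
rewrite product_measure1E; [|exact: values_meas|exact: signs_meas].
transitivity ((\prod_(a <- unzip1 s) letter_law a)%:E *
    (\prod_(b <- unzip2 s) @fair_coin R b)%:E)%E.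
  by congr (_ * _)%E; [exact: values_law|exact: signs_law].
rewrite -EFinM !big_map -big_split.
by congr EFin; apply: eq_bigr => b _; rewrite /signed_law /fair_coin div1r.
Qed.

Lemma unzip1_letters w : unzip1 (letters w) = values w.1.
Proof. by rewrite /unzip1 /= -map_comp. Qed.

Lemma zip_letters w : zip (values w.1) (signs w.2) = letters w.
Proof. by rewrite /= zip_map. Qed.

End Letters.

(** * Discretisation of a finite class *)

Section Discretisation.
Context (R : realType).

(** Rounding towards [0] on the grid of step [1 / (2 * N)].  The direction
    matters: rounding to the nearest point could increase second moments. *)
Definition quantize (N : nat) (y : R) : bool * 'I_N.+1 :=
  (y < 0, inord (Num.trunc (`|y| * (2 * N%:R)))).

Definition dequantize (N : nat) (c : bool * 'I_N.+1) : R :=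
  (-1) ^+ c.1 * ((c.2 : nat)%:R / (2 * N%:R)).

Lemma dequantize_le N c : `|dequantize (N := N) c| <= 1 / 2.
Proof.
rewrite /dequantize normrMsign; case: N c => [|N] c.
  by rewrite mulr0 invr0 mulr0 normr0.
rewrite ger0_norm ?divr_ge0 ?mulr_ge0// ler_pdivrMr ?mulr_gt0//.
by rewrite mulrA divfK// mul1r ler_nat -ltnS.
Qed.

Lemma quantize_trunc N y : `|y| <= 1 / 2 ->
  ((quantize N y).2 : nat) = Num.trunc (`|y| * (2 * N%:R)).
Proof.
move=> y2; rewrite /= inordK// ltnS -(ler_nat R).
have z0 : 0 <= `|y| * (2 * N%:R) by rewrite !mulr_ge0.
have /andP[z1 _] := truncn_itv z0; apply: (le_trans z1).
have : 0 <= N%:R :> R by [].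
by have := y2; nra.
Qed.

Lemma quantize_error N y : (0 < N)%N -> `|y| <= 1 / 2 ->
  `|dequantize (quantize N y)| <= `|y| /\
  `|dequantize (quantize N y) - y| <= N%:R^-1.
Proof.
move=> N0 y2; set z := `|y| * (2 * N%:R).
have N0' : 0 < N%:R :> R by rewrite ltr0n.
have NN : 0 < 2 * N%:R :> R by rewrite mulr_gt0.
have z0 : 0 <= z by rewrite !mulr_ge0.
have /andP[z1 z2] := truncn_itv z0.
rewrite /dequantize quantize_trunc// -/z; set k := Num.trunc z in z1 z2 *.
have k1 : k%:R / (2 * N%:R) <= `|y| by rewrite ler_pdivrMr.
have k2 : `|y| <= k%:R / (2 * N%:R) + N%:R^-1.
  have : `|y| <= k.+1%:R / (2 * N%:R) by rewrite ler_pdivlMr// ltW.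
  move=> /le_trans; apply; rewrite -natr1 mulrDl lerD2l div1r.
  by rewrite lef_pV2 ?posrE//; lra.
have q0 : 0 <= k%:R / (2 * N%:R) :> R by rewrite divr_ge0// ltW.
split; first by rewrite normrMsign ger0_norm.
have -> : (-1) ^+ (quantize N y).1 * (k%:R / (2 * N%:R)) - y =
    (-1) ^+ (quantize N y).1 * (k%:R / (2 * N%:R) - `|y|).
  rewrite /=; case: (ltP y 0) => y0.
    by rewrite (ltr0_norm y0) expr1; ring.
  by rewrite (ger0_norm y0) expr0; ring.
by rewrite normrMsign ler0_norm; lra.
Qed.

Lemma discretisation (d : measure_display) (S : measurableType d) (J : finType)
    (h : J -> S -> R) (N : nat) : (0 < N)%N ->
  (forall j, measurable_fun [set: S] (h j)) ->
  (forall j x, `|h j x| <= 1 / 2) ->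
  exists (A : finType) (pi : S -> A) (g : J -> A -> R),
  [/\ forall a, measurable (pi @^-1` [set a]),
      forall j a, `|g j a| <= 1 / 2,
      forall j x, `|g j (pi x)| <= `|h j x| &
      forall j x, `|g j (pi x) - h j x| <= N%:R^-1].
Proof.
move=> N0 mh hb.
exists {ffun J -> bool * 'I_N.+1}, (fun x => [ffun j => quantize N (h j x)]),
  (fun j (a : {ffun J -> bool * 'I_N.+1}) => dequantize (a j)); split => [a|j a|j x|j x].
- have -> : (fun x => [ffun j => quantize N (h j x)]) @^-1` [set a] =
      \big[setI/setT]_(j <- enum J) [set x | quantize N (h j x) = a j].
    apply/seteqP; split => x /=.
      by move=> <-; elim/big_ind: _ => [//|? ? ? ?|j _]; [split|rewrite /= ffunE].
    move=> H; apply/ffunP => j; rewrite ffunE; move: H.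
    by rewrite (bigD1_seq j) ?mem_enum ?enum_uniq//= => -[].
  apply: bigsetI_measurable => j _; case: (a j) => b k.
  have -> : [set x | quantize N (h j x) = (b, k)] =
      [set x | (h j x < 0) = b] `&`
      ((fun x => `|h j x| * (2 * N%:R)) @^-1` `[k%:R, k.+1%:R[%classic).
    apply/seteqP; split => x.
      move=> /= E; split; first by case: E.
      have := quantize_trunc N (hb j x); rewrite E /= => kE.
      have z0 : 0 <= `|h j x| * (2 * N%:R) by rewrite !mulr_ge0.
      by rewrite in_itv /= kE; exact: truncn_itv.
    move=> /= [E]; rewrite in_itv /= => kz; apply/pair_equal_spec; split => //.
    apply/ord_inj; rewrite -[LHS]/((quantize N (h j x)).2 : nat) quantize_trunc//.
    exact: truncn_def.
  apply: measurableI.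
    have := measurable_fun_ltr (mh j) (measurable_cst (0 : R)).
    move=> /(_ measurableT [set b] I); rewrite setTI.
    by congr measurable; apply/seteqP; split => x /=.
  rewrite -[X in measurable X]setTI; apply: (_ : measurable_fun setT _) => //.
  apply: measurable_funM; last exact: measurable_cst.
  exact: measurableT_comp (mh j).
- exact: dequantize_le.
- by rewrite ffunE; case: (quantize_error N0 (hb j x)).
- by rewrite ffunE; case: (quantize_error N0 (hb j x)).
Qed.

End Discretisation.

(** * Tail bounds for a finite class, up to the rounding error *)

Section FiniteClass.
Context (R : realType) (dS dX de : measure_display)
  (S : measurableType dS) (P : probability S R)
  (OX : measurableType dX) (PX : probability OX R)
  (Oe : measurableType de) (Pe : probability Oe R).
Variables (X : {RV PX >-> S}) (Xs : nat -> {RV PX >-> S})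
  (eps : nat -> {RV Pe >-> R}).
Hypothesis X_law : has_law X P.
Hypothesis Xs_law : forall i, has_law (Xs i) P.
Hypothesis Xs_indep : mutually_independent Xs.
Hypothesis eps_law : forall i, rademacher (eps i).
Hypothesis eps_indep : mutually_independent eps.

(** The sign agrees with [eps i] almost surely and takes the values [1] and
    [-1] everywhere, which keeps all suprema bounded. *)
Definition sign_of (i : nat) (w : OX * Oe) : R := (-1) ^+ (eps i w.2 == -1).
Definition mean (f : S -> R) : R := fine 'E_PX[f \o X].

Variables (J : finType) (h : J -> S -> R) (j0 : J) (s2 : R) (n N : nat).
Hypothesis h_meas : forall j, measurable_fun [set: S] (h j).
Hypothesis h_bounded : forall j x, `|h j x| <= 1 / 2.
Hypothesis h_var : forall j, Rintegral P [set: S] (fun x => h j x ^+ 2) <= s2.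
Hypothesis s2_le : s2 <= 1 / 4.
Hypothesis N_gt0 : (0 < N)%N.

Variables (Y : OX * Oe -> R) (c : R).
Hypothesis Y_meas : measurable_fun [set: OX * Oe] Y.
Hypothesis Y_bounded : forall w, `|Y w| <= c.
Hypothesis Y_dominates : forall w j,
  `|\sum_(i < n) sign_of i w * h j (Xs i w.1)| <= Y w.

Let Pr : probability _ R := (PX \x Pe)%E.
Let delta : R := N%:R^-1.

Lemma section_measurable w1 : measurable_fun [set: Oe] (fun w2 => Y (w1, w2)).
Proof. exact: measurableT_comp Y_meas (pair1_measurable w1). Qed.

(** [Y] stands for the supremum over a class that contains all [h j], and the
    two events for the two parts of the theorem with the supremum of the
    centred sums replaced by that over the [h j].  Rounding costs [delta] per
    summand in [Y] and [2 * delta] in the centred sums (one for the value, one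
    for the mean), hence [4 * n * delta] in all; the further [delta] is the
    slack left for the exhaustion of the class. *)
Lemma finite_class_tail (t : R) (E1 E2 : set (OX * Oe)) :
  let t' := t - (1 + 4 * n%:R) * delta / 3 in
  let V' := n%:R * s2 + 4 * (Rintegral Pr [set: OX * Oe] Y + n%:R * delta) in
  0 < t' -> measurable E1 -> measurable E2 ->
  (forall w, E1 w -> exists j, 2 * Y w + 3 * t - delta <=
     `|\sum_(i < n) (h j (Xs i w.1) - mean (h j))|) ->
  (forall w, E2 w -> exists j,
     2 * Rintegral Pe [set: Oe] (fun w2 => Y (w.1, w2)) + 3 * t - delta <=
     `|\sum_(i < n) (h j (Xs i w.1) - mean (h j))|) ->
  (Pr E1 <= (2 * expR (- (t' ^+ 2 / (2 * V' + 2 * t'))))%:E)%E /\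
  (Pr E2 <= (2 * expR (- (t' ^+ 2 / (2 * V' + 2 * t'))))%:E)%E.
Proof.
move=> t' V' t'0 mE1 mE2 hE1 hE2.
have [A [pi [g [pi_meas g_bounded g_le g_close]]]] :=
  discretisation N_gt0 h_meas h_bounded.
have delta0 : 0 <= delta by rewrite /delta invr_ge0.
pose p := letter_law P pi.
have p0 := letter_law_ge0 P pi; have p1 := letter_law_sum1 P pi_meas.
rewrite -/p in p0 p1.
pose Q := signed_law p.
pose Yd := normax (rademacher_signed g) j0.
pose Zd := normax (centered p g) j0.
pose L := letters Xs eps pi n.
have L_meas := letters_meas Xs eps (n := n) pi_meas.
have L_law := letters_law (n := n) Xs_law Xs_indep eps_law eps_indep pi_meas.
rewrite -/L in L_meas L_law.
have sumL w j : sumk (rademacher_signed g) j (L w) =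
    \sum_(i < n) sign_of i w * g j (pi (Xs i w.1)).
  by rewrite /sumk /L /letters /= big_map big_enum.
have sumV (w : OX * Oe) j : sumk (centered p g) j (values Xs pi n w.1) =
    \sum_(i < n) (g j (pi (Xs i w.1)) - \sum_a p a * g j a).
  by rewrite /sumk /values /= big_map big_enum.
have gvar j : \sum_a p a * g j a ^+ 2 <= s2.
  have gi_meas := measurable_finite_valued pi_meas (fun a => g j a ^+ 2).
  rewrite -(Rintegral_finite_law pi_meas (letter_law_P P pi_meas) (fun a => g j a ^+ 2)).
  apply: le_trans (h_var j).
  have sq (y : R) : `|y| <= 1 / 2 -> `|y ^+ 2| <= 1 / 4.
    by move=> y2; rewrite normrX; have := normr_ge0 y; nra.
  apply: le_Rintegral => //.
  - by apply: (@bounded_integrable _ _ _ P _ (1 / 4)) => // x; exact: sq.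
  - apply: (@bounded_integrable _ _ _ P _ (1 / 4)) => [|x]; last exact: sq.
    exact: measurable_funX.
  - move=> x _; rewrite -[leLHS]real_normK ?num_real// -[leRHS]real_normK ?num_real//.
    by rewrite lerXn2r ?nnegrE.
have gmean j : `|\sum_a p a * g j a - mean (h j)| <= delta.
  have mX a : measurable ((pi \o X) @^-1` [set a]).
    exact: measurable_funPTI (pi_meas a).
  have lX a : PX ((pi \o X) @^-1` [set a]) = (p a)%:E.
    by rewrite -(letter_law_P P pi_meas); exact: X_law.
  rewrite -(Rintegral_finite_law mX lX (g j)).
  rewrite /mean unlock -/(Rintegral PX [set: OX] (h j \o X)).
  have m1 := measurable_finite_valued mX (g j).
  have m2 : measurable_fun [set: OX] (h j \o X) by exact: measurableT_comp.
  have b1 w : `|g j ((pi \o X) w)| <= 1 / 2 by exact: g_bounded.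
  have b2 w : `|(h j \o X) w| <= 1 / 2 by exact: h_bounded.
  have close w : `|g j ((pi \o X) w) - (h j \o X) w| <= delta by exact: g_close.
  have H1 := @Rintegral_shift_le _ _ _ PX _ _ delta _ _ m1 m2 b1 b2.
  have H2 := @Rintegral_shift_le _ _ _ PX _ _ delta _ _ m2 m1 b2 b1.
  have K1 : Rintegral PX [set: OX] (fun w => g j ((pi \o X) w)) <=
      Rintegral PX [set: OX] (h j \o X) + delta.
    by apply: H1 => w; have := close w; rewrite ler_norml => /andP[]; lra.
  have K2 : Rintegral PX [set: OX] (h j \o X) <=
      Rintegral PX [set: OX] (fun w => g j ((pi \o X) w)) + delta.
    by apply: H2 => w; have := close w; rewrite ler_norml => /andP[]; lra.
  by rewrite ler_norml; apply/andP; split; lra.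
have sum_close (u v : 'I_n -> R) e : (forall i, `|u i - v i| <= e) ->
    `|\sum_(i < n) u i| <= `|\sum_(i < n) v i| + n%:R * e.
  move=> uv; rewrite -lerBlDl.
  apply: (le_trans (lerB_dist _ _)); rewrite -sumrB.
  apply: (le_trans (ler_norm_sum _ _ _)).
  apply: (le_trans (ler_sum _ (fun i _ => uv i))).
  by rewrite sumr_const card_ord mulr_natl.
have Yclose (w : OX * Oe) : Yd (L w) <= Y w + n%:R * delta.
  have [j E] := normax_attained (rademacher_signed g) j0 (L w).
  rewrite /Yd E sumL; apply: le_trans (_ : _ <=
    `|\sum_(i < n) sign_of i w * h j (Xs i w.1)| + n%:R * delta) _.
    by apply: sum_close => i; rewrite -mulrBr normrMsign; exact: g_close.
  by rewrite lerD2r.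
have Zclose (w : OX * Oe) j : `|\sum_(i < n) (h j (Xs i w.1) - mean (h j))| <=
    Zd (values Xs pi n w.1) + n%:R * (2 * delta).
  apply: le_trans (_ : _ <= `|sumk (centered p g) j (values Xs pi n w.1)| +
    n%:R * (2 * delta)) _; last by rewrite lerD2r normax_ge.
  rewrite sumV; apply: sum_close => i.
  rewrite (_ : _ - _ = (\sum_a p a * g j a - mean (h j)) -
    (g j (pi (Xs i w.1)) - h j (Xs i w.1))); last by ring.
  apply: (le_trans (ler_normB _ _)).
  by have := gmean j; have := g_close j (Xs i w.1); rewrite -/delta; lra.
have EYd : expect Q n Yd <= Rintegral Pr [set: OX * Oe] Y + n%:R * delta.
  rewrite expect_tuple -(Rintegral_finite_law L_meas L_law (fun s => Yd s)).
  apply: (Rintegral_shift_le Pr (measurable_finite_valued L_meas (fun s => Yd s))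
    Y_meas (finite_valued_bounded L (fun s => Yd s)) Y_bounded) => w.
  exact: Yclose.
have Mclose (w : OX * Oe) : sign_mean g j0 n (values Xs pi n w.1) <=
    Rintegral Pe [set: Oe] (fun w2 => Y (w.1, w2)) + n%:R * delta.
  have s_meas := signs_meas eps (n := n).
  have s_law := signs_law eps_law eps_indep (n := n).
  pose phi (s : n.-tuple bool) := Yd (zip (values Xs pi n w.1) s).
  rewrite /sign_mean expect_tuple -(Rintegral_finite_law s_meas s_law phi).
  apply: (Rintegral_shift_le Pe (measurable_finite_valued s_meas phi)
    (section_measurable w.1) (finite_valued_bounded (signs eps n) phi)
    (fun w2 => Y_bounded (w.1, w2))) => w2.
  by rewrite /phi (zip_letters _ _ _ _ (w.1, w2)); exact: Yclose.
have V'_ge : n%:R * s2 + 4 * expect Q n Yd <= V'.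
  by rewrite /V' lerD2l ler_wpM2l.
have Vd0 : 0 <= n%:R * s2 + 4 * expect Q n Yd.
  apply: addr_ge0.
    apply: mulr_ge0 => //; apply: le_trans (gvar j0).
    by apply: sumr_ge0 => a _; rewrite mulr_ge0 ?sqr_ge0.
  apply: mulr_ge0 => //; apply: expect_ge0 => [b||s _].
  - exact: signed_law_ge0.
  - exact: signed_law_sum1.
  - exact: normax_ge0.
have tail_mono := ler_gamma_tail t'0 Vd0 V'_ge.
have transfer (T : OX * Oe -> R) (Td : seq (A * bool) -> R) (E : set (OX * Oe)) :
    measurable E ->
    (forall w, Td (L w) <= T w + n%:R * delta) ->
    (forall w, E w -> exists j, 2 * T w + 3 * t - delta <=
       `|\sum_(i < n) (h j (Xs i w.1) - mean (h j))|) ->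
    expect Q n (fun s => (2 * Td s + 3 * t' <= Zd (unzip1 s))%R%:R) <=
      2 * expR (- (t' ^+ 2 / (2 * (n%:R * s2 + 4 * expect Q n Yd) + 2 * t'))) ->
    (Pr E <= (2 * expR (- (t' ^+ 2 / (2 * V' + 2 * t'))))%:E)%E.
  move=> mE Tclose hE fin.
  pose b (s : n.-tuple (A * bool)) := 2 * Td s + 3 * t' <= Zd (unzip1 s).
  apply: (@le_trans _ _ (Pr [set w | b (L w)])).
    apply: le_measure; rewrite ?inE//; first exact: measurable_finite_event.
    move=> w /hE [j Hj]; rewrite /= /b unzip1_letters.
    have := Zclose w j; have := Tclose w; rewrite /t'; lra.
  rewrite (prob_finite_law L_meas L_law) lee_fin.
  move: fin; rewrite expect_tuple => /le_trans; apply.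
  exact: ler_wpM2l.
split.
- apply: (transfer Y Yd E1 mE1 Yclose hE1).
  exact: finite_tail_signs.
- apply: (transfer _ (fun s => sign_mean g j0 n (unzip1 s)) E2 mE2 _ hE2).
    by move=> w; rewrite unzip1_letters; exact: Mclose.
  exact: finite_tail_mean.
Qed.

End FiniteClass.

(** * Suprema over a countable class and limits of tail bounds *)

Section Supnorm.
Context (R : realType) (U : Type) (F : set U).

Lemma supnorm0 (H : U -> R) : F = set0 -> supnorm F H = 0.
Proof. by move=> ->; rewrite /supnorm image_set0 sup0. Qed.

Variables (H : U -> R) (c : R) (f0 : U).
Hypothesis F_f0 : F f0.
Hypothesis H_bounded : forall f, F f -> `|H f| <= c.

Let image_has_sup : has_sup [set `|H f| | f in F].
Proof.
by split; [exists `|H f0|, f0|exists c => _ [f Ff <-]; exact: H_bounded].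
Qed.

Lemma supnorm_ge f : F f -> `|H f| <= supnorm F H.
Proof. by move=> Ff; apply: ub_le_sup; [case: image_has_sup|exists f]. Qed.

Lemma supnorm_le : supnorm F H <= c.
Proof.
by apply: ge_sup; [case: image_has_sup|move=> _ [f Ff <-]; exact: H_bounded].
Qed.

Lemma supnorm_adherent e : 0 < e -> exists2 f, F f & supnorm F H - e < `|H f|.
Proof.
by move=> e0; have [_ [f Ff <-] He] := sup_adherent e0 image_has_sup; exists f.
Qed.

End Supnorm.

Lemma measurable_supnorm (d : measure_display) (T : measurableType d)
    (R : realType) (U : Type) (F : set U) (fs : nat -> U) (H : T -> U -> R)
    (c : T -> R) :
  (forall k, F (fs k)) -> (forall f, F f -> exists k, fs k = f) ->
  (forall w f, F f -> `|H w f| <= c w) ->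
  (forall k, measurable_fun [set: T] (fun w => H w (fs k))) ->
  measurable_fun [set: T] (fun w => supnorm F (H w)).
Proof.
move=> Ffs fsF Hc mH.
rewrite (_ : (fun w => _) = (fun w => sups (fun k => `|H w (fs k)|) 0)).
  apply: measurable_fun_sups => [w _|k].
    by exists (c w) => _ [k _ <-]; exact: Hc.
  exact: measurableT_comp (mH k).
apply/funext => w; rewrite /supnorm /sups /sdrop /=; congr sup.
apply/seteqP; split => [_ [f Ff <-]|_ [k _ <-]].
  by have [k <-] := fsF _ Ff; exists k.
by exists (fs k).
Qed.

Lemma countable_enumeration (U : Type) (F : set U) : countable F -> F !=set0 ->
  exists fs : nat -> U, (forall k, F (fs k)) /\ (forall f, F f -> exists k, fs k = f).
Proof.
move=> /pfcard_geP[->|[g] _]; first by case.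
exists g; split; first by move=> k; exact: funS.
by move=> f Ff; have [k _ <-] := @surj _ _ _ _ g f Ff; exists k.
Qed.

Lemma measurable_ler_set (d : measure_display) (T : measurableType d)
    (R : realType) (f g : T -> R) :
  measurable_fun [set: T] f -> measurable_fun [set: T] g ->
  measurable [set w | f w <= g w].
Proof.
move=> mf mg; have := measurable_fun_ler mf mg measurableT (Y := [set true]) I.
by rewrite setTI; congr measurable; apply/seteqP; split.
Qed.

(** The exponent depends on [d = N^-1] in a Lipschitz way near [0], with the
    constant [K] of the proof, so that [p * expR (- (K * d))] is at most
    the claimed bound; then [expR (- (K * d)) >= 1 - K * d] and [p <= 1] show
    that the error is at most [K * d]. *)
Lemma tail_limit (R : realType) (p t V K1 K2 : R) :
  0 < t -> 0 <= V -> 0 <= K1 -> 0 <= K2 -> 0 <= p <= 1 ->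
  (forall N, (0 < N)%N -> 0 < t - K1 * N%:R^-1 ->
     p <= 2 * expR (- ((t - K1 * N%:R^-1) ^+ 2 /
       (2 * (V + K2 * N%:R^-1) + 2 * (t - K1 * N%:R^-1))))) ->
  p <= 2 * expR (- (t ^+ 2 / (2 * V + 2 * t))).
Proof.
move=> t0 V0 K10 K20 /andP[p0 p1] H.
set D := 2 * V + 2 * t; have D0 : 0 < D by rewrite /D; lra.
set x := t ^+ 2 / D; have x0 : 0 <= x by rewrite divr_ge0 ?sqr_ge0 ?ltW.
pose K := 2 * t * K1 / D + x * (2 * K2) / D.
have K0 : 0 <= K.
  apply: addr_ge0; apply: divr_ge0 (ltW D0).
    by apply: mulr_ge0 => //; apply: mulr_ge0 => //; exact: ltW.
  by apply: mulr_ge0 => //; exact: mulr_ge0.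
apply/ler_addgt0Pr => e e0.
pose m := e^-1 * (K + 1) + t^-1 * (K1 + 1).
have m0 : 0 < m by rewrite addr_gt0// mulr_gt0 ?invr_gt0//; lra.
pose N := (Num.trunc m).+1; pose d : R := N%:R^-1.
have mN : m < N%:R by exact: truncnS_gt.
have d0 : 0 < d by rewrite invr_gt0 ltr0n.
have md : m * d < 1 by rewrite /d ltr_pdivrMr ?ltr0n// mul1r.
have de : K * d <= e.
  have : e^-1 * (K + 1) * d <= 1.
    apply: le_trans (ltW md); rewrite ler_pM2r// /m lerDl.
    by rewrite mulr_ge0 ?invr_ge0//; lra.
  by rewrite -mulrA mulrC ler_pdivrMr// mul1r; nra.
have dt : K1 * d < t.
  have : t^-1 * (K1 + 1) * d <= 1.
    apply: le_trans (ltW md); rewrite ler_pM2r// /m lerDr.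
    by rewrite mulr_ge0 ?invr_ge0//; lra.
  by rewrite -mulrA mulrC ler_pdivrMr// mul1r; nra.
have tt0 : 0 < t - K1 * d by rewrite subr_gt0.
have {H} := H N isT tt0; rewrite -/d => H.
have ple : p <= 2 * expR (- x + K * d).
  apply: (le_trans H); rewrite ler_wpM2l// ler_expR.
  rewrite -[X in _ <= X]opprK lerN2 opprD opprK.
  set y := _ / _.
  have DD0 : 0 < 2 * (V + K2 * d) + 2 * (t - K1 * d).
    by have := mulr_ge0 K20 (ltW d0); lra.
  rewrite /y ler_pdivlMr//.
  have xD : x * D = t ^+ 2 by rewrite /x divfK ?gt_eqF.
  have KD : K * D = 2 * t * K1 + x * (2 * K2).
    by rewrite /K; field; rewrite gt_eqF.
  have xKd : x - K * d <= x by rewrite gerBl mulr_ge0// ltW.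
  have [neg|pos] := leP (x - K * d) 0.
    apply: le_trans (_ : 0 <= _); last exact: sqr_ge0.
    by rewrite mulr_le0_ge0// ltW.
  apply: (@le_trans _ _ ((x - K * d) * (D + 2 * K2 * d))).
    rewrite ler_pM2l// /D.
    by have := mulr_ge0 K10 (ltW d0); lra.
  have -> : (x - K * d) * (D + 2 * K2 * d) = x * D + x * (2 * K2) * d
     - (K * D) * d - K * d * (2 * K2 * d) by ring.
  rewrite xD KD.
  have : 0 <= K * d * (2 * K2 * d) by rewrite !mulr_ge0// ltW.
  by have := sqr_ge0 (K1 * d); nra.
have E : 2 * expR (- x + K * d) * expR (- (K * d)) = 2 * expR (- x).
  by rewrite -mulrA -expRD addrK.
have : p * expR (- (K * d)) <= 2 * expR (- x).
  by rewrite -E ler_wpM2r// expR_ge0.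
have := ler_wpM2l p0 (expR_ge1Dx (- (K * d))).
have : p * (K * d) <= 1 * (K * d).
  by apply: ler_wpM2r => //; rewrite mulr_ge0// ltW.
by lra.
Qed.

Section AlmostSureSigns.
Context (R : realType) (dX de : measure_display)
  (OX : measurableType dX) (PX : probability OX R)
  (Oe : measurableType de) (Pe : probability Oe R).
Variable eps : nat -> {RV Pe >-> R}.
Hypothesis eps_law : forall i, rademacher (eps i).

Definition bad_signs : set Oe :=
  \bigcup_i ~` (eps i @^-1` [set 1] `|` eps i @^-1` [set -1]).

Let pm_meas i y : measurable (eps i @^-1` [set y]).
Proof. exact: measurable_funPTI. Qed.

Lemma bad_signs_meas : measurable bad_signs.
Proof.
apply: bigcup_measurable => i _; apply: measurableC.
by apply: measurableU.
Qed.

Lemma bad_signs_null : Pe bad_signs = 0%E.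
Proof.
have null i : Pe (~` (eps i @^-1` [set 1] `|` eps i @^-1` [set -1])) = 0%E.
  rewrite probability_setC; last exact: measurableU.
  have [e1 em1] := eps_law i.
  have -> : Pe (eps i @^-1` [set 1] `|` eps i @^-1` [set -1]) =
      (Pe (eps i @^-1` [set 1%R]) + Pe (eps i @^-1` [set (-1)%R]))%E.
    rewrite measureU//; apply/seteqP; split => // y [/= -> H].
    by have : (1 : R) = -1 := H; lra.
  have half : ((2^-1)%:E + (2^-1)%:E)%E = 1%:E :> \bar R.
    by rewrite -EFinD; congr EFin; lra.
  by rewrite e1 em1 half subee.
apply/negligibleP; first exact: bad_signs_meas.
apply: negligible_bigcup => i; apply/negligibleP; last exact: null.
by apply: measurableC; exact: measurableU.
Qed.

Lemma sign_of_good i (w : OX * Oe) :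
  ~ bad_signs w.2 -> sign_of eps i w = eps i w.2.
Proof.
move=> good; rewrite /sign_of.
have : (eps i @^-1` [set 1] `|` eps i @^-1` [set -1]) w.2.
  by apply: contrapT => H; apply: good; exists i.
case=> /= ->; last by rewrite eqxx expr1.
by rewrite (_ : (1 == -1) = false) ?expr0//; apply/negbTE/eqP; lra.
Qed.

Lemma measurable_sign_of i : measurable_fun [set: OX * Oe] (sign_of eps i).
Proof.
rewrite /sign_of.
apply: (@measurable_finite_valued _ _ _ bool (fun w => eps i w.2 == -1) _
  (fun b : bool => (-1) ^+ b)) => b.
have -> : (fun w : OX * Oe => eps i w.2 == -1) @^-1` [set b] =
    snd @^-1` (eps i @^-1` [set y | (y == -1) = b]) by [].
rewrite -[X in measurable X]setTI; apply: measurable_snd => //.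
exact: measurable_funPTI (sign_set_meas b).
Qed.

End AlmostSureSigns.

(** * Countable classes *)

Section CountableClass.
Context (R : realType) (dS dX de : measure_display)
  (S : measurableType dS) (P : probability S R)
  (OX : measurableType dX) (PX : probability OX R)
  (Oe : measurableType de) (Pe : probability Oe R).
Variables (X : {RV PX >-> S}) (Xs : nat -> {RV PX >-> S})
  (eps : nat -> {RV Pe >-> R}).
Hypothesis X_law : has_law X P.
Hypothesis Xs_law : forall i, has_law (Xs i) P.
Hypothesis Xs_indep : mutually_independent Xs.
Hypothesis eps_law : forall i, rademacher (eps i).
Hypothesis eps_indep : mutually_independent eps.
Variables (F : set (S -> R)) (fs : nat -> S -> R) (s2 : R) (n : nat).
Hypothesis F_fs : forall k, F (fs k).
Hypothesis fs_F : forall f, F f -> exists k, fs k = f.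
Hypothesis F_measurable : forall f, F f -> measurable_fun [set: S] f.
Hypothesis F_bounded : forall f, F f -> forall x, `|f x| <= 1 / 2.
Hypothesis F_var : forall f, F f -> Rintegral P [set: S] (fun x => f x ^+ 2) <= s2.
Hypothesis s2_le : s2 <= 1 / 4.

Let Pr : probability _ R := (PX \x Pe)%E.
Let Z : OX * Oe -> R := empirical_norm X Xs F n.
Let Zeps : OX * Oe -> R := rademacher_norm Xs eps F n.
Let Zsign (w : OX * Oe) : R :=
  supnorm F (fun f => \sum_(i < n) sign_of eps i w * f (Xs i w.1)).

Let deviation (f : S -> R) (w : OX * Oe) : R :=
  \sum_(i < n) (f (Xs i w.1) - mean X f).

Lemma norm_mean_le f : F f -> `|mean X f| <= 1 / 2.
Proof.
move=> Ff; rewrite /mean unlock -/(Rintegral PX [set: OX] (f \o X)).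
have m1 : measurable_fun [set: OX] (f \o X).
  by apply: measurableT_comp => //; exact: F_measurable.
have m0 : measurable_fun [set: OX] (fun=> 0 : R) by exact: measurable_cst.
have b1 w : `|(f \o X) w| <= 1 / 2 by exact: F_bounded.
have b0 (w : OX) : `|(0 : R)| <= 0 by rewrite normr0.
have I0 : Rintegral PX [set: OX] (fun=> 0 : R) = 0 by rewrite Rintegral_cst// mul0r.
have := @Rintegral_shift_le _ _ _ PX _ _ (1 / 2) _ _ m1 m0 b1 b0.
have := @Rintegral_shift_le _ _ _ PX _ _ (1 / 2) _ _ m0 m1 b0 b1.
rewrite I0 => H1 H2; rewrite ler_norml; apply/andP; split.
  rewrite -[leLHS]sub0r lerBlDr; apply: H1 => w; rewrite -lerBlDr sub0r.
  by have := b1 w; rewrite ler_norml => /andP[].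
rewrite -[leRHS]add0r; apply: H2 => w; rewrite add0r.
exact: le_trans (ler_norm _) (b1 w).
Qed.

Lemma measurable_letter f i : F f ->
  measurable_fun [set: OX * Oe] (fun w => f (Xs i w.1)).
Proof.
move=> Ff; apply: (measurableT_comp (F_measurable Ff)).
by apply: measurableT_comp => //; exact: measurable_fst.
Qed.

Lemma measurable_deviation f : F f -> measurable_fun [set: OX * Oe] (deviation f).
Proof.
move=> Ff; apply: measurable_sum => i; apply: measurable_funB.
  exact: measurable_letter.
exact: measurable_cst.
Qed.

Lemma norm_deviation_le w f : F f -> `|deviation f w| <= n%:R.
Proof.
move=> Ff; apply: (le_trans (ler_norm_sum _ _ _)).
apply: (@le_trans _ _ (\sum_(i < n) (1 : R))).
  apply: ler_sum => i _; apply: (le_trans (ler_normB _ _)).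
  by have := F_bounded Ff (Xs i w.1); have := norm_mean_le Ff; lra.
by rewrite sumr_const card_ord.
Qed.

Lemma measurable_Z : measurable_fun [set: OX * Oe] Z.
Proof.
apply: (measurable_supnorm (c := fun=> n%:R) F_fs fs_F) => [w f|k].
  exact: norm_deviation_le.
exact: measurable_deviation.
Qed.

Lemma norm_signed_sum_le (a : nat -> R) w f : F f ->
  `|\sum_(i < n) a i * f (Xs i w)| <= \sum_(i < n) `|a i| / 2.
Proof.
move=> Ff; apply: (le_trans (ler_norm_sum _ _ _)); apply: ler_sum => i _.
by rewrite normrM ler_wpM2l// -[leRHS]div1r F_bounded.
Qed.

Lemma measurable_Zeps : measurable_fun [set: OX * Oe] Zeps.
Proof.
apply: (measurable_supnorm (c := fun w => \sum_(i < n) `|eps i w.2| / 2) F_fs fs_F).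
  by move=> w f Ff; exact: (norm_signed_sum_le (fun i => eps i w.2)).
move=> k; apply: measurable_sum => i; apply: measurable_funM.
  by apply: measurableT_comp => //; exact: measurable_snd.
exact: measurable_letter.
Qed.

Lemma rademacher_norm_ge0 w : 0 <= Zeps w.
Proof.
apply: le_trans (normr_ge0 _) (supnorm_ge (F_fs 0) _ (F_fs 0)) => f.
exact: (norm_signed_sum_le (fun i => eps i w.2)).
Qed.

Lemma norm_sign_sum_le w f : F f ->
  `|\sum_(i < n) sign_of eps i w * f (Xs i w.1)| <= n%:R / 2.
Proof.
move=> Ff; apply: le_trans (norm_signed_sum_le (fun i => sign_of eps i w) w.1 Ff) _.
under eq_bigr => i _ do rewrite normr_sign.
by rewrite -mulr_suml sumr_const card_ord.
Qed.

Lemma measurable_Zsign : measurable_fun [set: OX * Oe] Zsign.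
Proof.
apply: (measurable_supnorm (c := fun=> n%:R / 2) F_fs fs_F) => [w f|k].
  exact: norm_sign_sum_le.
apply: measurable_sum => i; apply: measurable_funM.
  exact: measurable_sign_of.
exact: measurable_letter.
Qed.

Lemma Zsign_ge0 w : 0 <= Zsign w.
Proof.
apply: le_trans (normr_ge0 _) (supnorm_ge (F_fs 0) _ (F_fs 0)) => f.
exact: norm_sign_sum_le.
Qed.

Lemma norm_Zsign_le w : `|Zsign w| <= n%:R / 2.
Proof.
rewrite ger0_norm ?Zsign_ge0//; apply: (supnorm_le (F_fs 0)) => f.
exact: norm_sign_sum_le.
Qed.

Lemma Zeps_good w : ~ bad_signs eps w.2 -> Zeps w = Zsign w.
Proof.
move=> good; rewrite /Zeps /rademacher_norm /Zsign; congr supnorm.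
apply/funext => f; apply: eq_bigr => i _.
by rewrite (sign_of_good i good).
Qed.

Lemma sign_mean_Zeps w :
  Eeps Pe Zeps w = Rintegral Pe [set: Oe] (fun w2 => Zsign (w.1, w2)).
Proof.
rewrite /Eeps unlock /Rintegral; congr fine.
apply: ae_eq_integral => //.
- apply/measurable_EFinP.
  exact: measurableT_comp measurable_Zeps (measurable_pair1 w.1).
- apply/measurable_EFinP.
  exact: measurableT_comp measurable_Zsign (measurable_pair1 w.1).
exists (bad_signs eps); split.
- exact: bad_signs_meas.
- exact: bad_signs_null.
move=> w2 /= H; apply: contrapT => good; apply: H => _.
by rewrite Zeps_good.
Qed.

Let bad_pairs : set (OX * Oe) := setT `*` bad_signs eps.

Let bad_pairs_meas : measurable bad_pairs.
Proof. by apply: measurableX => //; exact: bad_signs_meas. Qed.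

Let bad_pairs_null : Pr bad_pairs = 0%E.
Proof.
transitivity (PX setT * Pe (bad_signs eps))%E.
  by apply: product_measure1E => //; exact: bad_signs_meas.
by rewrite bad_signs_null// mule0.
Qed.

Lemma mean_Zeps : fine 'E_Pr[Zeps] = Rintegral Pr [set: OX * Oe] Zsign.
Proof.
rewrite unlock /Rintegral; congr fine; apply: ae_eq_integral => //.
- by apply/measurable_EFinP; exact: measurable_Zeps.
- by apply/measurable_EFinP; exact: measurable_Zsign.
exists bad_pairs; split => // w /= H; split => //=.
by apply: contrapT => good; apply: H => _; rewrite Zeps_good.
Qed.

Lemma measurable_sign_mean : measurable_fun [set: OX * Oe]
  (fun w => Rintegral Pe [set: Oe] (fun w2 => Zsign (w.1, w2))).
Proof.
have mf : measurable_fun [set: OX * Oe] (EFin \o Zsign).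
  by apply/measurable_EFinP; exact: measurable_Zsign.
have f0 w : (0 <= (EFin \o Zsign) w)%E by rewrite lee_fin Zsign_ge0.
have := @measurable_fun_fubini_tonelli_F _ _ OX Oe R Pe _ mf f0.
move=> mF; apply: (measurableT_comp (f := fun w1 =>
  fine (fubini_F Pe (EFin \o Zsign) w1)) _ (@measurable_fst _ _ OX Oe)).
by apply: measurableT_comp mF; exact: fine_measurable.
Qed.

(** The supremum is approached within [e] by some [fs k], so the event is
    covered by an increasing union to which continuity of the measure
    applies. *)
Lemma finite_subclass_limit (T : OX * Oe -> R) (t e beta : R) : 0 < e ->
  measurable_fun [set: OX * Oe] T ->
  (forall m, Pr (\bigcup_(k < m.+1)
     [set w | (2 * T w + 3 * t - e <= `|deviation (fs k) w|)%R]) <= beta%:E)%E ->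
  (Pr [set w | (2 * T w + 3 * t <= Z w)%R] <= beta%:E)%E.
Proof.
move=> e0 mT H.
pose D k := [set w | 2 * T w + 3 * t - e <= `|deviation (fs k) w|].
have mlin : measurable_fun [set: OX * Oe] (fun w => 2 * T w + 3 * t).
  apply: measurable_funD; last exact: measurable_cst.
  by apply: measurable_funM => //; exact: measurable_cst.
have mD k : measurable (D k).
  apply: measurable_ler_set; first by apply: measurable_funB => //; exact: measurable_cst.
  exact: measurableT_comp (measurable_deviation (F_fs k)).
pose E m := \bigcup_(k < m.+1) D k.
have mE m : measurable (E m) by apply: bigcup_measurable.
have mUE : measurable (\bigcup_m E m) by apply: bigcup_measurable.
apply: (@le_trans _ _ (Pr (\bigcup_m E m))).
  apply: le_measure; rewrite ?inE//.
    by apply: measurable_ler_set => //; exact: measurable_Z.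
  move=> w /= TZ.
  have [f Ff fZ] := supnorm_adherent (F_fs 0) (@norm_deviation_le w) e0.
  have [k kf] := fs_F Ff; exists k => //; exists k => //=.
  rewrite /D /= kf; apply: le_trans (ltW fZ).
  by rewrite lerD2r.
have homE : {homo E : m k / (m <= k)%N >-> (m <= k)%O}.
  move=> m k mk; apply/subsetPset => w [j /= jm Dj]; exists j => //=.
  exact: leq_trans jm _.
have cvgE := nondecreasing_cvg_mu (mu := Pr) mE mUE homE.
by apply: (cvge_to_le cvgE); apply: nearW => m; exact: H.
Qed.

Lemma countable_class_tail (t : R) : 0 < t ->
  let V := n%:R * s2 + 4 * fine 'E_Pr[Zeps] in
  (Pr [set w | (2 * Zeps w + 3 * t <= Z w)%R] <=
     (2 * expR (- (t ^+ 2 / (2 * V + 2 * t))))%:E)%E /\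
  (Pr [set w | (2 * Eeps Pe Zeps w + 3 * t <= Z w)%R] <=
     (2 * expR (- (t ^+ 2 / (2 * V + 2 * t))))%:E)%E.
Proof.
move=> t0 V.
pose M (w : OX * Oe) := Rintegral Pe [set: Oe] (fun w2 => Zsign (w.1, w2)).
have s20 : 0 <= s2.
  by apply: le_trans (F_var (F_fs 0)); apply: Rintegral_ge0 => x _; exact: sqr_ge0.
have V0 : 0 <= V.
  apply: addr_ge0; first exact: mulr_ge0.
  rewrite mean_Zeps mulr_ge0//; apply: Rintegral_ge0 => w _; exact: Zsign_ge0.
have event_meas (T : OX * Oe -> R) : measurable_fun [set: OX * Oe] T ->
    measurable [set w | 2 * T w + 3 * t <= Z w].
  move=> mT; apply: measurable_ler_set; last exact: measurable_Z.
  apply: measurable_funD; last exact: measurable_cst.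
  by apply: measurable_funM => //; exact: measurable_cst.
pose K1 : R := (1 + 4 * n%:R) / 3; pose K2 : R := 4 * n%:R.
have K10 : 0 <= K1 by rewrite /K1 divr_ge0// addr_ge0// mulr_ge0.
have K20 : 0 <= K2 by rewrite mulr_ge0.
have tails N : (0 < N)%N -> 0 < t - K1 * N%:R^-1 ->
    let beta := 2 * expR (- ((t - K1 * N%:R^-1) ^+ 2 /
       (2 * (V + K2 * N%:R^-1) + 2 * (t - K1 * N%:R^-1)))) in
    (Pr [set w | (2 * Zsign w + 3 * t <= Z w)%R] <= beta%:E)%E /\
    (Pr [set w | (2 * M w + 3 * t <= Z w)%R] <= beta%:E)%E.
  move=> N0 tN beta.
  have e0 : 0 < (N%:R^-1 : R) by rewrite invr_gt0 ltr0n.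
  have subclass m := @finite_class_tail _ _ _ _ S P OX PX Oe Pe X Xs eps X_law
    Xs_law Xs_indep eps_law eps_indep 'I_m.+1 (fun j => fs j) ord0 s2 n N
    (fun j => F_measurable (F_fs j)) (fun j => F_bounded (F_fs j))
    (fun j => F_var (F_fs j)) s2_le N0 Zsign (n%:R / 2) measurable_Zsign
    norm_Zsign_le (fun w j => supnorm_ge (F_fs 0) (@norm_sign_sum_le w) (F_fs j)) t.
  have tE : t - (1 + 4 * n%:R) * N%:R^-1 / 3 = t - K1 * N%:R^-1.
    by rewrite /K1; ring.
  have VE : n%:R * s2 + 4 * (Rintegral Pr [set: OX * Oe] Zsign + n%:R * N%:R^-1) =
      V + K2 * N%:R^-1 by rewrite /V mean_Zeps /K2; ring.
  pose E (T : OX * Oe -> R) m := \bigcup_(k < m.+1)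
     [set w | 2 * T w + 3 * t - N%:R^-1 <= `|deviation (fs k) w|].
  have mE T m : measurable_fun [set: OX * Oe] T -> measurable (E T m).
    move=> mT; apply: bigcup_measurable => k _; apply: measurable_ler_set.
      apply: measurable_funB; last exact: measurable_cst.
      apply: measurable_funD; last exact: measurable_cst.
      by apply: measurable_funM => //; exact: measurable_cst.
    exact: measurableT_comp (measurable_deviation (F_fs k)).
  have hE T m w : E T m w -> exists j : 'I_m.+1,
      2 * T w + 3 * t - N%:R^-1 <= `|deviation (fs j) w|.
    by move=> [k /= km Hk]; exists (Ordinal km).
  have both m : (Pr (E Zsign m) <= beta%:E)%E /\ (Pr (E M m) <= beta%:E)%E.
    have := subclass m (E Zsign m) (E M m); rewrite /= tE VE; apply => //.
    - exact: (mE Zsign m measurable_Zsign).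
    - exact: (mE M m measurable_sign_mean).
    - exact: hE.
    - exact: hE.
  split.
  - apply: (finite_subclass_limit e0 measurable_Zsign) => m.
    by case: (both m).
  - apply: (finite_subclass_limit e0 measurable_sign_mean) => m.
    by case: (both m).
have limit (A : set (OX * Oe)) : measurable A ->
    (forall N, (0 < N)%N -> 0 < t - K1 * N%:R^-1 ->
      (Pr A <= (2 * expR (- ((t - K1 * N%:R^-1) ^+ 2 /
       (2 * (V + K2 * N%:R^-1) + 2 * (t - K1 * N%:R^-1)))))%:E)%E) ->
    (Pr A <= (2 * expR (- (t ^+ 2 / (2 * V + 2 * t))))%:E)%E.
  move=> mA HA.
  have PA : Pr A = (fine (Pr A))%:E by rewrite fineK// fin_num_measure.
  rewrite PA lee_fin; apply: (tail_limit t0 V0 K10 K20) => [|N N0 tN].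
    by rewrite fine_ge0//= -lee_fin -PA probability_le1.
  by rewrite -lee_fin -PA; exact: HA.
split.
- apply: (@le_trans _ _ (Pr [set w | (2 * Zsign w + 3 * t <= Z w)%R])).
    rewrite -(measureU0 (event_meas _ measurable_Zsign) bad_pairs_meas bad_pairs_null).
    apply: le_measure; rewrite ?inE.
    + exact: event_meas measurable_Zeps.
    + by apply: measurableU => //; exact: event_meas measurable_Zsign.
    move=> w /= TZ; have [bad|good] := pselect (bad_signs eps w.2); first by right.
    by left; rewrite -Zeps_good.
  by apply: (limit _ (event_meas _ measurable_Zsign)) => N N0 tN; case: (tails N N0 tN).
- have -> : [set w | 2 * Eeps Pe Zeps w + 3 * t <= Z w] =
      [set w | 2 * M w + 3 * t <= Z w].
    by apply/seteqP; split => w /=; rewrite sign_mean_Zeps.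
  by apply: (limit _ (event_meas _ measurable_sign_mean)) => N N0 tN; case: (tails N N0 tN).
Qed.

End CountableClass.

Theorem proposition2 (R : realType) (dS dX de : measure_display)
  (S : measurableType dS) (P : probability S R)
  (OX : measurableType dX) (PX : probability OX R)
  (Oe : measurableType de) (Pe : probability Oe R)
  (X : {RV PX >-> S}) (Xs : nat -> {RV PX >-> S})
  (eps : nat -> {RV Pe >-> R})
  (hX : has_law X P)
  (hXs_law : forall i, has_law (Xs i) P)
  (hXs_indep : mutually_independent Xs)
  (heps_law : forall i, rademacher (eps i))
  (heps_indep : mutually_independent eps)
  (F : set (S -> R))
  (F_countable : countable F)
  (F_measurable : forall f, F f -> measurable_fun [set: S] f)
  (F_bounded : forall f, F f -> forall x, `|f x| <= 1 / 2)
  (sigma : R)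
  (sigma_le : sigma <= 1 / 2)
  (sigma_ge : sup [set \int[P]_x (f x ^+ 2) | f in F] <= sigma ^+ 2)
  (n : nat) :
  let Pr := (PX \x Pe)%E in
  let Z : OX * Oe -> R := empirical_norm X Xs F n in
  let Zeps : OX * Oe -> R := rademacher_norm Xs eps F n in
  let V' : R := n%:R * sigma ^+ 2 + 4 * fine 'E_Pr[Zeps] in
  forall t : R, 0 < t ->
    (Pr [set w | 2 * Zeps w + 3 * t <= Z w]%R
      <= (2 * expR (- (t ^+ 2 / (2 * V' + 2 * t))))%R%:E)%E
    /\
    (Pr [set w | 2 * Eeps Pe Zeps w + 3 * t <= Z w]%R
      <= (2 * expR (- (t ^+ 2 / (2 * V' + 2 * t))))%R%:E)%E.
Proof.
move=> Pr Z Zeps V' t t0.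
set beta := 2 * expR _.
have beta0 : 0 <= beta by rewrite mulr_ge0// expR_ge0.
have [F0|/eqP/set0P Fne] := pselect (F = set0).
  have empty (T : OX * Oe -> R) : (forall w, 0 <= T w) ->
      (Pr [set w | (2 * T w + 3 * t <= Z w)%R] <= beta%:E)%E.
    move=> T0; have -> : [set w | 2 * T w + 3 * t <= Z w] = set0.
      apply/seteqP; split => // w /=.
      by rewrite /Z /empirical_norm supnorm0//; have := T0 w; lra.
    by rewrite [X in (X <= _)%E](measure0 (PX \x Pe)%E) lee_fin.
  have Zeps0 w : 0 <= Zeps w by rewrite /Zeps /rademacher_norm supnorm0.
  by split; apply: empty => // w; apply: fine_ge0; exact: expectation_ge0.
have [fs [F_fs fs_F]] := countable_enumeration F_countable Fne.
have sq f x : F f -> `|f x ^+ 2| <= 1 / 4.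
  by move=> Ff; rewrite normrX; have := F_bounded f Ff x; have := normr_ge0 (f x); nra.
have var_le f : F f -> Rintegral P [set: S] (fun x => f x ^+ 2) <= 1 / 4.
  move=> Ff; have m0 : measurable_fun [set: S] (fun=> 0 : R) by exact: measurable_cst.
  have mf : measurable_fun [set: S] (fun x => f x ^+ 2).
    by apply: measurable_funX; exact: F_measurable.
  have b0 (x : S) : `|(0 : R)| <= 0 by rewrite normr0.
  have := @Rintegral_shift_le _ _ _ P _ _ (1 / 4) _ _ mf m0 (fun x => sq f x Ff) b0.
  rewrite Rintegral_cst// mul0r add0r; apply => x.
  exact: le_trans (ler_norm _) (sq f x Ff).
(* [sigma] may be a large negative number, while [mgf_lower] needs a variance
   bound of at most [1 / 4]; the functions being bounded by [1 / 2], there is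
   one that is also at most [sigma ^+ 2]. *)
pose s2 := Num.min (sigma ^+ 2) (1 / 4).
have F_var f : F f -> Rintegral P [set: S] (fun x => f x ^+ 2) <= s2.
  move=> Ff; rewrite le_min var_le// andbT; apply: le_trans sigma_ge.
  apply: ub_le_sup; last by exists f.
  by exists (1 / 4) => _ [f' Ff' <-]; exact: var_le.
have s2_le : s2 <= 1 / 4 by rewrite ge_min lexx orbT.
have s2_sigma : s2 <= sigma ^+ 2 by rewrite ge_min lexx.
have [tail1 tail2] := countable_class_tail hX hXs_law hXs_indep heps_law
  heps_indep n F_fs fs_F F_measurable F_bounded F_var s2_le t0.
have s20 : 0 <= s2.
  by rewrite le_min sqr_ge0 divr_ge0.
have EY0 : 0 <= fine 'E_Pr[Zeps].
  apply: fine_ge0; apply: expectation_ge0 => w.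
  exact: (rademacher_norm_ge0 Xs eps n F_fs F_bounded).
have V0 : 0 <= n%:R * s2 + 4 * fine 'E_Pr[Zeps].
  by apply: addr_ge0; apply: mulr_ge0.
have VV' : n%:R * s2 + 4 * fine 'E_Pr[Zeps] <= V' by rewrite lerD2r ler_wpM2l.
have mono := ler_wpM2l (ler0n R 2) (ler_gamma_tail t0 V0 VV').
by split; [apply: le_trans tail1 _|apply: le_trans tail2 _]; rewrite lee_fin.
Qed.
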